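(* Let $\hat f(z)=z+\beta_4z^4+\beta_7z^7+\cdots$ be a $3$-fold symmetric function in $\mathscr{S}^*_\wp$ (equivalently $\hat f(z)=(f(z^3))^{1/3}$ for some $f\in\mathscr{S}^*_\wp$). Then its third Hankel determinant satisfies $|H_3(1)|=|\beta_4|^2\le 1/9$, and the bound is sharp (attained by $\hat f(z)=z\exp\left(\tfrac13(e^{z^3}-1)\right)$).
   Context: $\mathbb{D}$ is the unit disk; $\mathcal{A}$ is the class of analytic $f$ on $\mathbb{D}$ with $f(0)=0,f'(0)=1$, written $f(z)=z+\sum_{k\ge2}b_kz^k$. $f\prec g$ means $f=g\circ\omega$ for analytic $\omega:\mathbb{D}\to\mathbb{D}$, $\omega(0)=0$. $\wp(z)=1+ze^z$, $\mathscr{S}^*_\wp=\{f\in\mathcal{A}:zf'(z)/f(z)\prec\wp(z)\}$. $f$ is $3$-fold symmetric if $f(e^{2\pi i/3}z)=e^{2\pi i/3}f(z)$ for all $z\in\mathbb{D}$. The third Hankel determinant is $H_3(1)=\det\begin{pmatrix}1&b_2&b_3\\ b_2&b_3&b_4\\ b_3&b_4&b_5\end{pmatrix}$, which for a $3$-fold symmetric function equals $-b_4^2$. *)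

(* Defs.v *)
From Stdlib Require Import Reals.
From Coquelicot Require Import Coquelicot.
Open Scope C_scope.

Definition in_disk (z : C) : Prop := (Cmod z < 1)%R.

Definition cexp (z : C) : C :=
  (exp (fst z) * cos (snd z), exp (fst z) * sin (snd z))%R.

Definition wp (z : C) : C := 1 + z * cexp z.

Definition analytic_on_disk (g : C -> C) : Prop :=
  forall z, in_disk z -> ex_derive g z.

Definition schwarz (w : C -> C) : Prop :=
  analytic_on_disk w /\ w 0 = 0 /\ forall z, in_disk z -> in_disk (w z).

Definition in_class_A (f : C -> C) (b : nat -> C) : Prop :=
  (forall z, in_disk z -> is_pseries b z (f z)) /\ b O = 0 /\ b 1%nat = 1.

(* S*_wp : z f'(z)/f(z) is subordinate to wp, i.e. equals wp(omega z) for a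
   Schwarz function omega (the quotient being analytic on D, with value
   1 at z = 0, so f does not vanish on D \ {0}). *)
Definition in_S_wp (f : C -> C) (b : nat -> C) : Prop :=
  in_class_A f b /\
  exists w : C -> C, schwarz w /\
    forall z, in_disk z -> z <> 0 ->
      f z <> 0 /\ exists f'z, is_derive f z f'z /\ z * f'z / f z = wp (w z).

Definition eps3 : C := (cos (2 * PI / 3), sin (2 * PI / 3))%R.

Definition three_fold_symmetric (f : C -> C) : Prop :=
  forall z, in_disk z -> f (eps3 * z) = eps3 * f z.

(* Third Hankel determinant H_3(1) = det [[1,b2,b3],[b2,b3,b4],[b3,b4,b5]],
   expanded along the first row. *)
Definition H3 (b : nat -> C) : C :=
  1 * (b 3%nat * b 5%nat - b 4%nat * b 4%nat)
  - b 2%nat * (b 2%nat * b 5%nat - b 4%nat * b 3%nat)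
  + b 3%nat * (b 2%nat * b 4%nat - b 3%nat * b 3%nat).

Definition f_extremal (z : C) : C :=
  z * cexp ((cexp (z * z * z) - 1) / 3).

(* Main.v *)
Require Import Defs.
From Stdlib Require Import Arith Factorial Lra Lia.
From Stdlib Require Import Reals.
From Coquelicot Require Import Coquelicot.
Open Scope C_scope.

(** Write [f = z U].  The symmetry kills the coefficients [b_n] with [n <> 1 (mod 3)], since
    [b_n (eps^n - eps) = 0], so [U' = z^2 T] with [T(0) = 3 b_4], and the subordination
    reads [w e^w = z f'/f - 1 = z^3 T/U].  Hence [w = z^3 G] with [G = e^(-w) T/U], and the
    bound [|3 b_4| = |G(0)| <= 1] is the Schwarz lemma of order three.  No Cauchy theory
    is required: [T/U] comes from power series, so differentiating [w e^w] shows that [w']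
    is continuous, and then the means of [Re G] over the circles [|z| = r] do not depend
    on [r], because the Cauchy-Riemann equations turn their radial derivative into the
    integral of an angular one.

    For sharpness, [exp ((e^z - 1)/3)] is the sum of a power series whose coefficients
    are determined by the equation [3 E' = e^z E], a linear equation with a unique
    solution on the disk; the extremal function is [z E(z^3)]. *)

(** * Complex derivatives and the exponential *)

(** The Schwarz function is only assumed differentiable at each point, whereas differentiating a
    circle mean under the integral sign asks for a jointly continuous integrand. Goursat's theorem
    would supply this; here the condition |w| < 1 does, since it keeps the factor 1 + w of (w e^w)'
    nonzero, so that w' can be solved for. Means are taken of real parts because the integrals and
    the mean value theorem in use are real; the modulus is recovered by a rotation that makes the
    central value positive. On |z| = r one has |G| <= 1/r^3, and r tending to 1 gives the constant
    1. For sharpness, membership in the class includes a coefficient sequence, so the closed formula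
    of the extremal function is not enough: its Taylor series must be produced and shown to converge
    on the disk. The recursion keeps all coefficients at most 1 in modulus, which settles
    convergence. *)

Definition is_Cderive (f : C -> C) (z l : C) : Prop :=
  @is_derive C_AbsRing C_NormedModule f z l.

Definition is_Cseries (c : nat -> C) (l : C) : Prop :=
  @is_series C_AbsRing C_NormedModule c l.

(** The product and composition rules speak of C as a normed module over itself. Both structures
    share operations and norm, so the remainder condition is literally the same and only the
    linearity record is rebuilt. *)
Lemma is_Cderive_AbsRing (f : C -> C) (z l : C) :
  is_Cderive f z l <->
  @is_derive C_AbsRing (AbsRing_NormedModule C_AbsRing) f z l.
Proof.
  unfold is_Cderive, is_derive, filterdiff, is_domin; split; intros [[A B [M C]] H2]; split;
    solve [exact H2 | split; [exact A | exact B | exists M; exact C]].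
Qed.

Lemma is_Cderive_eps (f : C -> C) (z l : C) :
  is_Cderive f z l <->
  forall eps : posreal, exists delta : posreal, forall h : C,
    (Cmod h < delta)%R -> (Cmod (f (z + h) - f z - l * h)%C <= eps * Cmod h)%R.
Proof.
  split.
  - intros [_ H] eps.
    destruct (H z (fun P HP => HP) eps) as [d Hd].
    exists d; intros h Hh.
    assert (E : (z + h) - z = h) by ring.
    assert (B : (Cmod ((z + h) - z)%C < d)%R) by now rewrite E.
    specialize (Hd (z + h) B).
    change (Cmod ((f (z + h) - f z) - ((z + h) - z) * l)%C <= eps * Cmod ((z + h) - z)%C)%R in Hd.
    rewrite E in Hd.
    now replace (f (z + h) - f z - l * h) with (f (z + h) - f z - h * l) by ring.
  - intros H; split; [apply is_linear_scal_l|].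
    intros x Hx eps.
    assert (x = z) as -> by (symmetry; now apply (is_filter_lim_locally_unique (V := AbsRing_NormedModule C_AbsRing))).
    destruct (H eps) as [d Hd].
    exists d; intros y Hy.
    specialize (Hd (y - z) Hy).
    change (Cmod ((f y - f z) - (y - z) * l)%C <= eps * Cmod (y - z)%C)%R.
    assert (z + (y - z) = y :> C) as E by ring.
    rewrite E in Hd.
    now replace (f y - f z - (y - z) * l) with (f y - f z - l * (y - z)) by ring.
Qed.

Lemma is_Cderive_const (c z : C) : is_Cderive (fun _ => c) z 0.
Proof. apply (is_derive_const (K := C_AbsRing) (V := C_NormedModule)). Qed.

Lemma is_Cderive_id (z : C) : is_Cderive (fun x => x) z 1.
Proof. apply is_Cderive_AbsRing. apply (is_derive_id (K := C_AbsRing)). Qed.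

Lemma is_Cderive_plus (f g : C -> C) (z a b : C) :
  is_Cderive f z a -> is_Cderive g z b -> is_Cderive (fun x => f x + g x) z (a + b).
Proof. apply (is_derive_plus (K := C_AbsRing) (V := C_NormedModule)). Qed.

Lemma is_Cderive_minus (f g : C -> C) (z a b : C) :
  is_Cderive f z a -> is_Cderive g z b -> is_Cderive (fun x => f x - g x) z (a - b).
Proof. apply (is_derive_minus (K := C_AbsRing) (V := C_NormedModule)). Qed.

Lemma is_Cderive_mult (f g : C -> C) (z a b : C) :
  is_Cderive f z a -> is_Cderive g z b ->
  is_Cderive (fun x => f x * g x) z (a * g z + f z * b).
Proof.
  rewrite !is_Cderive_AbsRing; intros Hf Hg.
  apply (is_derive_mult (K := C_AbsRing)); auto; apply Cmult_comm.
Qed.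

Lemma is_Cderive_comp (f g : C -> C) (z a b : C) :
  is_Cderive f (g z) a -> is_Cderive g z b ->
  is_Cderive (fun x => f (g x)) z (b * a).
Proof.
  rewrite (is_Cderive_AbsRing g); intros Hf Hg.
  now apply (is_derive_comp (K := C_AbsRing) (V := C_NormedModule)).
Qed.

Lemma is_Cderive_of_eq (f : C -> C) (z a b : C) : is_Cderive f z a -> a = b -> is_Cderive f z b.
Proof. now intros H <-. Qed.

(** The derivatives found by explicit estimates (inverse, exponential, power series) all come with a
    quadratic remainder. Dividing by [K + 1] also covers [K = 0]. *)
Lemma is_Cderive_quadratic (f : C -> C) (z l : C) (r K : R) :
  (0 < r)%R -> (0 <= K)%R ->
  (forall h : C, (Cmod h < r)%R -> (Cmod (f (z + h) - f z - l * h)%C <= K * Cmod h ^ 2)%R) ->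
  is_Cderive f z l.
Proof.
  intros Hr HK H; apply is_Cderive_eps; intros [eps He].
  assert (0 < eps / (K + 1))%R as Hq by (apply Rdiv_lt_0_compat; lra).
  exists (mkposreal (Rmin r (eps / (K + 1))) (Rmin_pos _ _ Hr Hq)).
  simpl; intros h Hh.
  eapply Rle_trans; [apply H; eapply Rlt_le_trans; [exact Hh|apply Rmin_l]|].
  assert (Cmod h <= eps / (K + 1))%R as H1.
  { apply Rlt_le; eapply Rlt_le_trans; [exact Hh|apply Rmin_r]. }
  assert (Cmod h * (K + 1) <= eps)%R as H2.
  { apply (Rmult_le_compat_r (K + 1)) in H1; [|lra].
    replace (eps / (K + 1) * (K + 1))%R with eps in H1 by (field; lra). exact H1. }
  pose proof (Cmod_ge_0 h).
  assert (K * Cmod h <= eps)%R by nra.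
  nra.
Qed.

(** The remainder is exactly h^2 / (z^2 (z + h)), and |h| < |z|/2 forces |z + h| >= |z|/2; hence the
    constant 2/|z|^3. *)
Lemma is_Cderive_inv (z : C) : z <> 0 -> is_Cderive (fun x => / x) z (- / (z * z)).
Proof.
  intros Hz; pose proof (proj1 (Cmod_gt_0 z) Hz) as Hp.
  apply (is_Cderive_quadratic _ _ _ (Cmod z / 2) (2 / Cmod z ^ 3)); [lra| |].
  { apply Rlt_le, Rdiv_lt_0_compat; [lra|now apply pow_lt]. }
  intros h Hh.
  assert (Hzh : (Cmod z / 2 <= Cmod (z + h))%R).
  { pose proof (Cmod_triangle (z + h) (- h)) as T. rewrite Cmod_opp in T.
    replace (z + h + - h) with z in T by ring. lra. }
  assert (z + h <> 0) as N by (apply Cmod_gt_0; lra).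
  replace (/ (z + h) - / z - - / (z * z) * h) with (h * h * / (z * z * (z + h))) by (field; auto).
  rewrite !Cmod_mult, Cmod_inv, !Cmod_mult; [|repeat apply Cmult_neq_0; auto].
  assert (/ (Cmod z * Cmod z * Cmod (z + h)) <= 2 / Cmod z ^ 3)%R as B.
  { replace (2 / Cmod z ^ 3)%R with (/ (Cmod z * Cmod z * (Cmod z / 2)))%R by (field; lra).
    apply Rinv_le_contravar; [repeat apply Rmult_lt_0_compat; lra|].
    apply Rmult_le_compat_l; [nra|lra]. }
  pose proof (Cmod_ge_0 h). nra.
Qed.

Lemma cexp_plus (a b : C) : cexp (a + b) = cexp a * cexp b.
Proof.
  destruct a as [a1 a2], b as [b1 b2]; unfold cexp, Cmult, Cplus; simpl.
  rewrite exp_plus, cos_plus, sin_plus; f_equal; ring.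
Qed.

Lemma cexp_0 : cexp 0 = 1.
Proof. unfold cexp; simpl. rewrite exp_0, cos_0, sin_0. unfold RtoC; f_equal; ring. Qed.

Lemma cexp_opp_l (a : C) : cexp (- a) * cexp a = 1.
Proof. rewrite <- cexp_plus. replace (- a + a) with (RtoC 0) by ring. apply cexp_0. Qed.

Lemma cexp_neq_0 (a : C) : cexp a <> 0.
Proof.
  intros H; pose proof (cexp_opp_l a) as E; rewrite H in E.
  apply C1_nz. rewrite <- E. ring.
Qed.

(** The inequality 1 + x <= e^x at -x gives e^x (1 - x) <= 1, hence e^x - 1 - x <= x^2 / (1 - x). *)
Lemma exp_sub_bound (x : R) : (Rabs x <= 1 / 2)%R -> (0 <= exp x - 1 - x <= 2 * x ^ 2)%R.
Proof.
  intros Hx; apply Rabs_le_between in Hx.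
  pose proof (exp_ineq1_le x); pose proof (exp_ineq1_le (- x)) as H2.
  rewrite exp_Ropp in H2.
  pose proof (exp_pos x) as Hp.
  split; [lra|].
  assert (exp x * (1 - x) <= 1)%R.
  { apply (Rmult_le_compat_l (exp x)) in H2; [|lra].
    rewrite Rinv_r in H2; lra. }
  nra.
Qed.

Lemma cos_sub_bound (y : R) : (0 <= 1 - cos y <= y ^ 2 / 2)%R.
Proof.
  split; [pose proof (COS_bound y); lra|].
  replace y with (2 * (y / 2))%R at 1 by field.
  rewrite cos_2a_sin.
  assert (Rabs (sin (y / 2)) <= Rabs (y / 2))%R as H.
  { pose proof (bounded_variation sin cos 1 0 (y / 2)) as B.
    rewrite sin_0, !Rminus_0_r, Rmult_1_l in B. apply B.
    intros t _; split; [apply is_derive_sin|apply Rabs_le, COS_bound]. }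
  apply Rsqr_le_abs_1 in H; unfold Rsqr in H. nra.
Qed.

(** Between 0 and y the derivative cos t - 1 is at most |y| in absolute value. The true cubic order
    is not pursued, since a quadratic remainder suffices. *)
Lemma sin_sub_bound (y : R) : (Rabs y <= 1)%R -> (Rabs (sin y - y) <= y ^ 2)%R.
Proof.
  intros Hy.
  pose proof (bounded_variation (fun t => sin t - t)%R (fun t => cos t - 1)%R (Rabs y) 0 y) as B.
  simpl in B; rewrite sin_0, !Rminus_0_r in B.
  replace (y ^ 2)%R with (Rabs y * Rabs y)%R by (rewrite <- (pow2_abs y); ring).
  apply B; intros t Ht; rewrite Rminus_0_r in Ht; split.
  - apply (is_derive_minus (K := R_AbsRing) (V := R_NormedModule) sin (fun t => t)); [apply is_derive_sin|apply (is_derive_id (K := R_AbsRing))].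
  - pose proof (cos_sub_bound t).
    rewrite Rabs_left1 by lra.
    rewrite <- (pow2_abs t) in H. pose proof (Rabs_pos t). nra.
Qed.

(** * Differentiation along curves *)

Lemma Cmod_le_abs (z : C) : (Cmod z <= Rabs (fst z) + Rabs (snd z))%R.
Proof.
  destruct z as [a b].
  replace (a, b) with (RtoC a + Ci * RtoC b) by
    (unfold RtoC, Ci, Cmult, Cplus; simpl; f_equal; ring).
  eapply Rle_trans; [apply Cmod_triangle|].
  rewrite Cmod_mult, Cmod_Ci, !Cmod_R; simpl.
  apply Req_le; f_equal; [f_equal|rewrite Rmult_1_l; f_equal]; ring.
Qed.

Lemma Rabs_fst_le_Cmod (z : C) : (Rabs (fst z) <= Cmod z)%R.
Proof. eapply Rle_trans; [apply Rmax_l|apply Rmax_Cmod]. Qed.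

Lemma Rabs_snd_le_Cmod (z : C) : (Rabs (snd z) <= Cmod z)%R.
Proof. eapply Rle_trans; [apply Rmax_r|apply Rmax_Cmod]. Qed.

(** Each component of the remainder is rewritten in terms of the one-variable errors of exp, cos and
    sin. The real part contributes 4 |h|^2 and the imaginary part 6 |h|^2. *)
Lemma cexp_sub_bound (h : C) :
  (Cmod h < 1 / 2)%R -> (Cmod (cexp h - 1 - h)%C <= 10 * Cmod h ^ 2)%R.
Proof.
  intros Hh.
  pose proof (Rabs_fst_le_Cmod h) as Hx; pose proof (Rabs_snd_le_Cmod h) as Hy.
  eapply Rle_trans; [apply Cmod_le_abs|].
  set (m := Cmod h) in *.
  destruct h as [x y]; simpl in *.
  pose proof (exp_sub_bound x ltac:(lra)) as Ex.
  pose proof (cos_sub_bound y) as Cy.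
  pose proof (sin_sub_bound y ltac:(lra)) as Sy.
  rewrite <- (pow2_abs x) in Ex. rewrite <- (pow2_abs y) in Cy, Sy.
  pose proof (Rabs_pos x); pose proof (Rabs_pos y).
  assert (Rabs x ^ 2 <= m ^ 2)%R by (apply pow_incr; lra).
  assert (Rabs y ^ 2 <= m ^ 2)%R by (apply pow_incr; lra).
  assert (Rabs (sin y) <= 1)%R as S1 by apply Rabs_le, SIN_bound.
  assert (Rabs (sin y) <= 2 * m)%R as S2.
  { replace (sin y) with ((sin y - y) + y)%R by ring.
    eapply Rle_trans; [apply Rabs_triang|]. nra. }
  assert (Rabs (cos y) <= 1)%R as C1 by apply Rabs_le, COS_bound.
  replace (exp x * cos y + - (1) + - x)%R
    with ((exp x - 1 - x) * cos y + (1 + x) * (cos y - 1))%R by ring.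
  replace (exp x * sin y + - 0 + - y)%R
    with ((exp x - 1 - x) * sin y + x * sin y + (sin y - y))%R by ring.
  assert (Rabs (exp x - 1 - x) <= 2 * m ^ 2)%R as E by (rewrite Rabs_pos_eq; lra).
  assert (Rabs (cos y - 1) <= m ^ 2)%R as Cc by (rewrite Rabs_left1; lra).
  assert (Rabs (1 + x) <= 3 / 2)%R as X1.
  { eapply Rle_trans; [apply Rabs_triang|]. rewrite Rabs_R1; lra. }
  pose proof (Rabs_pos (exp x - 1 - x)); pose proof (Rabs_pos (cos y - 1));
  pose proof (Rabs_pos (1 + x)); pose proof (Rabs_pos (sin y)); pose proof (Rabs_pos (cos y)).
  assert (Rabs ((exp x - 1 - x) * cos y + (1 + x) * (cos y - 1)) <= 4 * m ^ 2)%R.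
  { eapply Rle_trans; [apply Rabs_triang|]. rewrite !Rabs_mult. nra. }
  assert (Rabs ((exp x - 1 - x) * sin y + x * sin y + (sin y - y)) <= 6 * m ^ 2)%R.
  { eapply Rle_trans; [apply Rabs_triang|].
    eapply Rle_trans; [apply Rplus_le_compat_r, Rabs_triang|]. rewrite !Rabs_mult.
    assert (Rabs (exp x - 1 - x) * Rabs (sin y) <= 2 * m ^ 2)%R by nra.
    assert (Rabs x * Rabs (sin y) <= m * (2 * m))%R by (apply Rmult_le_compat; lra).
    nra. }
  lra.
Qed.

Lemma is_Cderive_cexp (z : C) : is_Cderive cexp z (cexp z).
Proof.
  apply (is_Cderive_quadratic _ _ _ (1 / 2) (Cmod (cexp z) * 10)); [lra| |].
  { pose proof (Cmod_ge_0 (cexp z)); lra. }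
  intros h Hh.
  rewrite cexp_plus.
  replace (cexp z * cexp h - cexp z - cexp z * h) with (cexp z * (cexp h - 1 - h)) by ring.
  rewrite Cmod_mult, Rmult_assoc.
  apply Rmult_le_compat_l; [apply Cmod_ge_0|now apply cexp_sub_bound].
Qed.

Lemma is_Rderive_eps (f : R -> R) (x l : R) :
  is_derive f x l <->
  forall eps : posreal, exists delta : posreal, forall h : R,
    (Rabs h < delta)%R -> (Rabs (f (x + h) - f x - l * h) <= eps * Rabs h)%R.
Proof.
  split.
  - intros [_ H] eps.
    destruct (H x (fun P HP => HP) eps) as [d Hd].
    exists d; intros h Hh.
    assert (E : ((x + h) - x = h)%R) by ring.
    assert (B : (Rabs ((x + h) - x) < d)%R) by now rewrite E.
    specialize (Hd (x + h)%R B).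
    change (Rabs ((f (x + h) - f x) - ((x + h) - x) * l) <= eps * Rabs ((x + h) - x))%R in Hd.
    rewrite E in Hd.
    now replace (f (x + h) - f x - l * h)%R with (f (x + h) - f x - h * l)%R by ring.
  - intros H; apply is_derive_Reals; intros eps He.
    destruct (H (mkposreal (eps / 2) ltac:(lra))) as [d Hd].
    exists d; intros h Hh0 Hh; specialize (Hd h Hh); simpl in Hd.
    replace ((f (x + h) - f x) / h - l)%R with ((f (x + h) - f x - l * h) / h)%R by (now field).
    unfold Rdiv; rewrite Rabs_mult, Rabs_inv.
    pose proof (Rabs_pos_lt h Hh0).
    apply (Rmult_lt_reg_r (Rabs h)); [easy|].
    rewrite Rmult_assoc, Rinv_l, Rmult_1_r by lra. nra.
Qed.

(** With k the increment of g, the remainder is (f (g + k) - f g - l k) + l (k - v h). The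
    tolerances make each summand at most (eps/2) |h|; capping [e2] by 1 ensures |k| <= (|v| + 2)
    |h|. *)
Lemma is_derive_fst_curve (f : C -> C) (g : R -> C) (t : R) (l v : C) :
  is_Cderive f (g t) l ->
  is_derive (fun s => fst (g s)) t (fst v) ->
  is_derive (fun s => snd (g s)) t (snd v) ->
  is_derive (fun s => fst (f (g s))) t (fst (l * v)).
Proof.
  rewrite is_Cderive_eps, !is_Rderive_eps; intros Hf H1 H2 [eps He].
  pose proof (Cmod_ge_0 v) as Pv; pose proof (Cmod_ge_0 l) as Pl.
  assert (0 < eps / 2 / (Cmod v + 2))%R as He1 by (apply Rdiv_lt_0_compat; lra).
  assert (0 < Rmin 1 (eps / 4 / (Cmod l + 1)))%R as He2.
  { apply Rmin_pos; [lra|apply Rdiv_lt_0_compat; lra]. }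
  destruct (Hf (mkposreal _ He1)) as [d0 Hd0].
  destruct (H1 (mkposreal _ He2)) as [d1 Hd1].
  destruct (H2 (mkposreal _ He2)) as [d2 Hd2]; simpl in *.
  set (e2 := Rmin 1 (eps / 4 / (Cmod l + 1))) in *.
  assert (e2 <= 1)%R as E1 by apply Rmin_l.
  assert (e2 * (Cmod l + 1) <= eps / 4)%R as E2.
  { assert (e2 <= eps / 4 / (Cmod l + 1))%R as A by apply Rmin_r.
    apply (Rmult_le_compat_r (Cmod l + 1)) in A; [|lra].
    replace (eps / 4 / (Cmod l + 1) * (Cmod l + 1))%R with (eps / 4)%R in A by (field; lra).
    exact A. }
  assert (0 < d0 / (Cmod v + 2))%R as Hd3 by (apply Rdiv_lt_0_compat; [apply cond_pos|lra]).
  exists (mkposreal _ (Rmin_pos _ _ (Rmin_pos _ _ (cond_pos d1) (cond_pos d2)) Hd3)).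
  simpl; intros h Hh.
  assert (Rabs h < d1)%R as L1.
  { eapply Rlt_le_trans; [exact Hh|]. eapply Rle_trans; [apply Rmin_l|apply Rmin_l]. }
  assert (Rabs h < d2)%R as L2.
  { eapply Rlt_le_trans; [exact Hh|]. eapply Rle_trans; [apply Rmin_l|apply Rmin_r]. }
  assert (Rabs h < d0 / (Cmod v + 2))%R as L3.
  { eapply Rlt_le_trans; [exact Hh|apply Rmin_r]. }
  specialize (Hd1 h L1); specialize (Hd2 h L2).
  set (k := g (t + h)%R - g t).
  assert (Hk : (Cmod (k - v * RtoC h)%C <= 2 * e2 * Rabs h)%R).
  { eapply Rle_trans; [apply Cmod_le_abs|].
    replace (fst (k - v * RtoC h)) with (fst (g (t + h)%R) - fst (g t) - fst v * h)%R by
      (unfold k; simpl; ring).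
    replace (snd (k - v * RtoC h)) with (snd (g (t + h)%R) - snd (g t) - snd v * h)%R by
      (unfold k; simpl; ring).
    lra. }
  pose proof (Rabs_pos h) as Ph.
  assert (Hk2 : (Cmod k <= (Cmod v + 2) * Rabs h)%R).
  { replace k with ((k - v * RtoC h) + v * RtoC h) by ring.
    eapply Rle_trans; [apply Cmod_triangle|]. rewrite Cmod_mult, Cmod_R. nra. }
  assert (Hk3 : (Cmod k < d0)%R).
  { eapply Rle_lt_trans; [exact Hk2|].
    apply (Rmult_lt_compat_l (Cmod v + 2)) in L3; [|lra].
    replace ((Cmod v + 2) * (d0 / (Cmod v + 2)))%R with (d0 : R) in L3 by (field; lra). exact L3. }
  specialize (Hd0 k Hk3).
  replace (g t + k) with (g (t + h)%R) in Hd0 by (unfold k; ring).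
  match goal with |- (Rabs ?x <= _)%R =>
    replace x with (fst ((f (g (t + h)%R) - f (g t) - l * k) + l * (k - v * RtoC h))%C)
      by (simpl; ring) end.
  eapply Rle_trans; [apply Rabs_fst_le_Cmod|].
  eapply Rle_trans; [apply Cmod_triangle|].
  rewrite Cmod_mult.
  assert (eps / 2 / (Cmod v + 2) * Cmod k <= eps / 2 * Rabs h)%R.
  { eapply Rle_trans; [apply Rmult_le_compat_l; [lra|exact Hk2]|].
    apply Req_le; field; lra. }
  assert (Cmod l * Cmod (k - v * RtoC h)%C <= eps / 2 * Rabs h)%R.
  { eapply Rle_trans; [apply Rmult_le_compat_l; [lra|exact Hk]|]. nra. }
  lra.
Qed.

(** The imaginary part of f is the real part of -i f. *)
Lemma is_derive_snd_curve (f : C -> C) (g : R -> C) (t : R) (l v : C) :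
  is_Cderive f (g t) l ->
  is_derive (fun s => fst (g s)) t (fst v) ->
  is_derive (fun s => snd (g s)) t (snd v) ->
  is_derive (fun s => snd (f (g s))) t (snd (l * v)).
Proof.
  intros Hf H1 H2.
  assert (H : is_Cderive (fun z => - Ci * f z) (g t) (0 * f (g t) + - Ci * l)).
  { apply (is_Cderive_mult (fun _ => - Ci) f); [apply is_Cderive_const|exact Hf]. }
  apply (is_derive_ext (fun s => fst (- Ci * f (g s)))); [intros s; simpl; ring|].
  replace (snd (l * v)) with (fst ((0 * f (g t) + - Ci * l) * v)) by (simpl; ring).
  now apply (is_derive_fst_curve (fun z => - Ci * f z)).
Qed.

Lemma is_Cderive_unique (f : C -> C) (z a b : C) :
  is_Cderive f z a -> is_Cderive f z b -> a = b.
Proof.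
  intros Ha Hb; rewrite <- (is_C_derive_unique f z a Ha); exact (is_C_derive_unique f z b Hb).
Qed.

Lemma is_Cderive_ext_disk (f g : C -> C) (z l : C) :
  (forall x, in_disk x -> f x = g x) -> in_disk z -> is_Cderive f z l -> is_Cderive g z l.
Proof.
  intros E Hz; rewrite !is_Cderive_eps; intros H eps.
  destruct (H eps) as [d Hd].
  assert (0 < 1 - Cmod z)%R as P by (unfold in_disk in Hz; lra).
  exists (mkposreal _ (Rmin_pos _ _ (cond_pos d) P)); simpl; intros h Hh.
  rewrite <- !E; [apply Hd; eapply Rlt_le_trans; [exact Hh|apply Rmin_l]|exact Hz|].
  unfold in_disk; eapply Rle_lt_trans; [apply Cmod_triangle|].
  assert (Cmod h < 1 - Cmod z)%R by (eapply Rlt_le_trans; [exact Hh|apply Rmin_r]). lra.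
Qed.

Lemma in_disk_scale (s : R) (z : C) : (0 <= s <= 1)%R -> in_disk z -> in_disk (RtoC s * z).
Proof.
  unfold in_disk; intros Hs Hz; rewrite Cmod_mult, Cmod_R, Rabs_pos_eq by lra.
  pose proof (Cmod_ge_0 z); nra.
Qed.

Lemma in_disk_0 : in_disk 0.
Proof. unfold in_disk; rewrite Cmod_0; lra. Qed.

(** Along the segment from 0 to z, both components become real functions with zero derivative. *)
Lemma Cderive_zero_constant (f : C -> C) :
  (forall z, in_disk z -> is_Cderive f z 0) -> forall z, in_disk z -> f z = f 0.
Proof.
  intros H z Hz.
  set (g := fun s : R => RtoC s * z).
  assert (D1 : forall s, is_derive (fun s => fst (g s)) s (fst z)).
  { intros s; apply (is_derive_ext (fun s => s * fst z)%R); [intros; simpl; ring|].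
    auto_derive; [exact I|ring]. }
  assert (D2 : forall s, is_derive (fun s => snd (g s)) s (snd z)).
  { intros s; apply (is_derive_ext (fun s => s * snd z)%R); [intros; simpl; ring|].
    auto_derive; [exact I|ring]. }
  assert (E0 : g 0%R = 0) by (unfold g; ring).
  assert (E1 : g 1%R = z) by (unfold g; ring).
  rewrite <- E1, <- E0; symmetry.
  apply injective_projections.
  - apply (eq_is_derive (fun s => fst (f (g s)))); [|lra].
    intros t Ht.
    replace (@zero R_NormedModule) with (fst (0 * z)) by (simpl; unfold zero; simpl; ring).
    apply (is_derive_fst_curve f g); [apply H, in_disk_scale; [lra|exact Hz]|apply D1|apply D2].
  - apply (eq_is_derive (fun s => snd (f (g s)))); [|lra].
    intros t Ht.
    replace (@zero R_NormedModule) with (snd (0 * z)) by (simpl; unfold zero; simpl; ring).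
    apply (is_derive_snd_curve f g); [apply H, in_disk_scale; [lra|exact Hz]|apply D1|apply D2].
Qed.

(* Integrating factor: [y * exp (- phi)] has derivative zero. *)
Lemma linear_ode_unique (y phi a : C -> C) :
  (forall z, in_disk z -> is_Cderive phi z (a z)) ->
  (forall z, in_disk z -> is_Cderive y z (a z * y z)) ->
  forall z, in_disk z -> y z * cexp (- phi z) = y 0 * cexp (- phi 0).
Proof.
  intros Hphi Hy.
  apply (Cderive_zero_constant (fun z => y z * cexp (- phi z))).
  intros z Hz.
  eapply is_Cderive_of_eq.
  - apply is_Cderive_mult; [now apply Hy|].
    apply (is_Cderive_comp cexp (fun z => - phi z)); [apply is_Cderive_cexp|].
    apply (is_derive_opp (K := C_AbsRing) (V := C_NormedModule) phi). now apply Hphi.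
  - unfold opp; simpl; ring.
Qed.

(** * Circle means *)

Definition polar (s t : R) : C := (s * cos t, s * sin t)%R.

Lemma Cmod_polar (s t : R) : Cmod (polar s t) = Rabs s.
Proof.
  unfold Cmod, polar; simpl.
  replace (s * cos t * (s * cos t * 1) + s * sin t * (s * sin t * 1))%R with (Rsqr s).
  - apply sqrt_Rsqr_abs.
  - pose proof (sin2_cos2 t) as H; unfold Rsqr in *.
    transitivity (s * s * (sin t * sin t + cos t * cos t))%R; [rewrite H|]; ring.
Qed.

Lemma in_disk_polar (s t : R) : (Rabs s < 1)%R -> in_disk (polar s t).
Proof. intros H; unfold in_disk; now rewrite Cmod_polar. Qed.

Lemma continuous_polar (s t : R) :
  @continuous (prod_UniformSpace R_UniformSpace R_UniformSpace) C_UniformSpace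
    (fun p => polar (fst p) (snd p)) (s, t).
Proof.
  assert (Hc : forall h : R -> R, (forall x, continuous h x) ->
    @continuous (prod_UniformSpace R_UniformSpace R_UniformSpace) R_UniformSpace
      (fun p => fst p * h (snd p))%R (s, t)).
  { intros h Hh.
    apply (continuous_mult (K := R_AbsRing) (fun p : R * R => fst p) (fun p => h (snd p))).
    - apply continuous_fst.
    - apply (continuous_comp (fun p : R * R => snd p) h); [apply continuous_snd|apply Hh]. }
  apply (continuous_comp_2 (V := R_UniformSpace) (W := R_UniformSpace)
    (fun p => fst p * cos (snd p))%R (fun p => fst p * sin (snd p))%R pair).
  - apply Hc; intros x; apply continuous_cos.
  - apply Hc; intros x; apply continuous_sin.
  - apply (continuous_ext (fun p => p)); [now intros []|apply continuous_id].
Qed.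

(** Differentiability yields continuity for neighbourhoods defined by the modulus; [locally_C] turns
    them into those of the product structure, which the real-variable lemmas expect. *)
Lemma ex_derive_continuous_C (f : C -> C) (z : C) :
  @ex_derive C_AbsRing C_NormedModule f z -> @continuous C_UniformSpace C_UniformSpace f z.
Proof.
  intros H P HP; apply ex_derive_continuous in H; specialize (H P HP).
  unfold filtermap in *. now apply locally_C.
Qed.

(* The integrand of the radial derivative of a circle mean. *)
Definition radial (g : C -> C) (s t : R) : R := fst (g (polar s t) * (cos t, sin t)).

(** Joint continuity is what differentiation under the integral sign asks for. In the study of
    circle means, the regularity of the derivative enters through this lemma. *)
Lemma continuous_radial (g : C -> C) (s t : R) :
  analytic_on_disk g -> (Rabs s < 1)%R ->
  @continuous (prod_UniformSpace R_UniformSpace R_UniformSpace) R_UniformSpace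
    (fun p => radial g (fst p) (snd p)) (s, t).
Proof.
  intros Hg Hs.
  assert (Hp : @continuous (prod_UniformSpace R_UniformSpace R_UniformSpace) C_UniformSpace
    (fun p => g (polar (fst p) (snd p))) (s, t)).
  { apply (continuous_comp (fun p : R * R => polar (fst p) (snd p)) g).
    - apply continuous_polar.
    - apply ex_derive_continuous_C, Hg, in_disk_polar, Hs. }
  unfold radial; simpl.
  apply (continuous_minus (V := R_NormedModule)
    (fun p : R * R => fst (g (polar (fst p) (snd p))) * cos (snd p))%R
    (fun p : R * R => snd (g (polar (fst p) (snd p))) * sin (snd p))%R).
  - apply (continuous_mult (K := R_AbsRing) (fun p : R * R => fst (g (polar (fst p) (snd p))))
      (fun p => cos (snd p))).
    + apply (continuous_comp (fun p : R * R => g (polar (fst p) (snd p))) (fun z : C => fst z));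
        [exact Hp|destruct (g _); apply continuous_fst].
    + apply (continuous_comp (fun p : R * R => snd p) cos); [apply continuous_snd|apply continuous_cos].
  - apply (continuous_mult (K := R_AbsRing) (fun p : R * R => snd (g (polar (fst p) (snd p))))
      (fun p => sin (snd p))).
    + apply (continuous_comp (fun p : R * R => g (polar (fst p) (snd p))) (fun z : C => snd z));
        [exact Hp|destruct (g _); apply continuous_snd].
    + apply (continuous_comp (fun p : R * R => snd p) sin); [apply continuous_snd|apply continuous_sin].
Qed.

Section CircleMean.

Context (f f1 : C -> C).
Hypothesis Df : forall z, in_disk z -> is_Cderive f z (f1 z).
Hypothesis Cf1 : analytic_on_disk f1.

Lemma is_derive_radius (s t : R) :
  (Rabs s < 1)%R -> is_derive (fun x => fst (f (polar x t))) s (radial f1 s t).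
Proof.
  intros Hs.
  apply (is_derive_fst_curve f (fun x => polar x t) s (f1 (polar s t)) (cos t, sin t)).
  - now apply Df, in_disk_polar.
  - unfold polar; simpl; auto_derive; [exact I|ring].
  - unfold polar; simpl; auto_derive; [exact I|ring].
Qed.

(** The velocity along the circle is the position turned by a right angle. The lemma serves to make
    the circle integrand continuous, hence integrable. *)
Lemma is_derive_angle_fst (s t : R) :
  (Rabs s < 1)%R ->
  is_derive (fun x => fst (f (polar s x))) t (fst (f1 (polar s t) * polar s (t + PI / 2))).
Proof.
  intros Hs.
  apply (is_derive_fst_curve f (fun x => polar s x)).
  - now apply Df, in_disk_polar.
  - unfold polar; simpl; auto_derive; [exact I|]. rewrite cos_plus, cos_PI2, sin_PI2; ring.
  - unfold polar; simpl; auto_derive; [exact I|]. rewrite sin_plus, cos_PI2, sin_PI2; ring.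
Qed.

(* The Cauchy-Riemann equations in polar coordinates. *)
Lemma is_derive_angle_snd (s t : R) :
  (Rabs s < 1)%R ->
  is_derive (fun x => snd (f (polar s x))) t (s * radial f1 s t)%R.
Proof.
  intros Hs.
  replace (s * radial f1 s t)%R with (snd (f1 (polar s t) * (- s * sin t, s * cos t)%R)%C)
    by (unfold radial; simpl; ring).
  apply (is_derive_snd_curve f (fun x => polar s x)).
  - now apply Df, in_disk_polar.
  - unfold polar; simpl; auto_derive; [exact I|ring].
  - unfold polar; simpl; auto_derive; [exact I|ring].
Qed.

Definition circle_integral (s : R) : R := RInt (fun t => fst (f (polar s t))) 0 (2 * PI).

Lemma ex_RInt_circle (s : R) :
  (Rabs s < 1)%R -> ex_RInt (fun t => fst (f (polar s t))) 0 (2 * PI).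
Proof.
  intros Hs; apply (ex_RInt_continuous (V := R_CompleteNormedModule)); intros t _.
  apply (ex_derive_continuous (K := R_AbsRing) (V := R_NormedModule)).
  eexists; now apply is_derive_angle_fst.
Qed.

Lemma is_derive_circle_integral (s : R) :
  (Rabs s < 1)%R ->
  is_derive circle_integral s (RInt (fun t => radial f1 s t) 0 (2 * PI)).
Proof.
  intros Hs.
  assert (P : (0 < 1 - Rabs s)%R) by lra.
  assert (N : forall y : R, (Rabs (y - s) < 1 - Rabs s)%R -> (Rabs y < 1)%R).
  { intros y Hy; replace y with ((y - s) + s)%R by ring.
    eapply Rle_lt_trans; [apply Rabs_triang|lra]. }
  rewrite <- (RInt_ext (fun t => Derive (fun x => fst (f (polar x t))) s)).
  2:{ intros t _; now apply is_derive_unique, is_derive_radius. }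
  apply (is_derive_RInt_param (fun x t => fst (f (polar x t)))).
  - exists (mkposreal _ P); intros y Hy t _.
    eexists; apply is_derive_radius, N, Hy.
  - intros t _.
    apply (continuity_2d_pt_ext_loc (radial f1)).
    + exists (mkposreal _ P); intros u v Hu _; symmetry.
      apply is_derive_unique, is_derive_radius, N, Hu.
    + apply continuity_2d_pt_filterlim.
      now apply (continuous_radial f1 s t).
  - exists (mkposreal _ P); intros y Hy; apply ex_RInt_circle, N, Hy.
Qed.

(** After multiplication by s the integrand is the angular derivative of the imaginary part, which
    integrates to zero over a full turn. Cancelling s requires s > 0. *)
Lemma RInt_radial (s : R) :
  (0 < s < 1)%R -> RInt (fun t => radial f1 s t) 0 (2 * PI) = 0%R.
Proof.
  intros Hs.
  assert (As : (Rabs s < 1)%R) by (rewrite Rabs_pos_eq; lra).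
  assert (Cr : forall t, continuous (fun t => radial f1 s t) t).
  { intros t.
    apply (continuous_comp (fun t : R => (s, t)) (fun p => radial f1 (fst p) (snd p))).
    - apply (continuous_comp_2 (fun _ : R => s) (fun t : R => t) pair).
      + apply continuous_const.
      + apply continuous_id.
      + apply (continuous_ext (fun p => p)); [now intros []|apply continuous_id].
    - now apply continuous_radial. }
  assert (H : is_RInt (fun t => s * radial f1 s t)%R 0 (2 * PI)
    (snd (f (polar s (2 * PI))) - snd (f (polar s 0)))%R).
  { apply (is_RInt_derive (V := R_CompleteNormedModule) (fun t => snd (f (polar s t)))).
    - intros t _; now apply is_derive_angle_snd.
    - intros t _. apply (continuous_scal_r (K := R_AbsRing) (V := R_NormedModule) s), Cr. }
  assert (E : polar s (2 * PI) = polar s 0).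
  { unfold polar; now rewrite cos_2PI, sin_2PI, cos_0, sin_0. }
  rewrite E in H.
  assert (H2 : is_RInt (fun t => s * radial f1 s t)%R 0 (2 * PI)
    (s * RInt (fun t => radial f1 s t) 0 (2 * PI))%R).
  { apply (is_RInt_scal (V := R_NormedModule) (fun t => radial f1 s t)).
    apply (RInt_correct (V := R_CompleteNormedModule)).
    apply (ex_RInt_continuous (V := R_CompleteNormedModule)); intros t _; apply Cr. }
  apply (is_RInt_unique (V := R_CompleteNormedModule)) in H, H2.
  rewrite H, Rminus_diag in H2.
  symmetry in H2; apply Rmult_integral in H2; destruct H2; [lra|easy].
Qed.

Lemma re_center_le_circle (r M : R) :
  (0 < r < 1)%R -> (forall t, fst (f (polar r t)) <= M)%R -> (fst (f 0) <= M)%R.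
Proof.
  intros Hr HM; pose proof PI_RGT_0 as Hpi.
  (* The derivative is known to vanish for positive radii only; at radius 0 the mean value theorem
     needs no more than continuity. *)
  destruct (MVT_gen circle_integral 0 r (fun _ => 0%R)) as [c [_ Hc]].
  - rewrite Rmin_left, Rmax_right by lra; intros x Hx.
    rewrite <- (RInt_radial x) by lra.
    apply is_derive_circle_integral; rewrite Rabs_pos_eq; lra.
  - rewrite Rmin_left, Rmax_right by lra; intros x Hx.
    apply continuity_pt_filterlim.
    apply (ex_derive_continuous (K := R_AbsRing) (V := R_NormedModule)).
    eexists; apply is_derive_circle_integral; rewrite Rabs_pos_eq; lra.
  - assert (H0 : circle_integral 0 = (2 * PI * fst (f 0))%R).
    { unfold circle_integral.
      rewrite (RInt_ext _ (fun _ => fst (f 0))).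
      - rewrite RInt_const; unfold scal; simpl; unfold mult; simpl; ring.
      - intros t _; do 2 f_equal; unfold polar, RtoC; f_equal; ring. }
    assert (H1 : (circle_integral r <= 2 * PI * M)%R).
    { replace (2 * PI * M)%R with (RInt (fun _ => M) 0 (2 * PI)).
      - apply RInt_le; [lra| |apply ex_RInt_const|intros; apply HM].
        apply ex_RInt_circle; rewrite Rabs_pos_eq; lra.
      - rewrite RInt_const; unfold scal; simpl; unfold mult; simpl; ring. }
    nra.
Qed.

End CircleMean.

(** Stands in for holomorphy: it gives a continuous derivative without Goursat's theorem and is
    closed under products, inverses and the exponential. *)
Definition twice_differentiable (f : C -> C) : Prop :=
  exists f1, (forall z, in_disk z -> is_Cderive f z (f1 z)) /\ analytic_on_disk f1.

Lemma twice_differentiable_analytic (f : C -> C) : twice_differentiable f -> analytic_on_disk f.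
Proof. intros [f1 [H _]] z Hz; exists (f1 z); now apply H. Qed.

Lemma analytic_mult (f g : C -> C) :
  analytic_on_disk f -> analytic_on_disk g -> analytic_on_disk (fun z => f z * g z).
Proof.
  intros Hf Hg z Hz; destruct (Hf z Hz) as [a Ha], (Hg z Hz) as [b Hb].
  eexists; exact (is_Cderive_mult f g z a b Ha Hb).
Qed.

Lemma analytic_plus (f g : C -> C) :
  analytic_on_disk f -> analytic_on_disk g -> analytic_on_disk (fun z => f z + g z).
Proof.
  intros Hf Hg z Hz; destruct (Hf z Hz) as [a Ha], (Hg z Hz) as [b Hb].
  eexists; exact (is_Cderive_plus f g z a b Ha Hb).
Qed.

Lemma analytic_const (c : C) : analytic_on_disk (fun _ => c).
Proof. intros z _; exists (RtoC 0); apply is_Cderive_const. Qed.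

Lemma analytic_id : analytic_on_disk (fun z => z).
Proof. intros z _; exists (RtoC 1); apply is_Cderive_id. Qed.

Lemma analytic_cexp (f : C -> C) : analytic_on_disk f -> analytic_on_disk (fun z => cexp (f z)).
Proof.
  intros Hf z Hz; destruct (Hf z Hz) as [a Ha].
  eexists; exact (is_Cderive_comp cexp f z _ a (is_Cderive_cexp _) Ha).
Qed.

Lemma analytic_inv (f : C -> C) :
  (forall z, in_disk z -> f z <> 0) -> analytic_on_disk f -> analytic_on_disk (fun z => / f z).
Proof.
  intros Nf Hf z Hz; destruct (Hf z Hz) as [a Ha].
  eexists; exact (is_Cderive_comp Cinv f z _ a (is_Cderive_inv _ (Nf z Hz)) Ha).
Qed.

Lemma twice_differentiable_mult (f g : C -> C) :
  twice_differentiable f -> twice_differentiable g -> twice_differentiable (fun z => f z * g z).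
Proof.
  intros Hf Hg.
  pose proof (twice_differentiable_analytic f Hf); pose proof (twice_differentiable_analytic g Hg).
  destruct Hf as [f1 [Df Af]], Hg as [g1 [Dg Ag]].
  exists (fun z => f1 z * g z + f z * g1 z); split.
  - intros z Hz; apply is_Cderive_mult; auto.
  - apply analytic_plus; apply analytic_mult; assumption.
Qed.

Lemma twice_differentiable_const (c : C) : twice_differentiable (fun _ => c).
Proof. exists (fun _ => RtoC 0); split; [intros; apply is_Cderive_const|apply analytic_const]. Qed.

Lemma twice_differentiable_id : twice_differentiable (fun z => z).
Proof. exists (fun _ => RtoC 1); split; [intros; apply is_Cderive_id|apply analytic_const]. Qed.

Lemma twice_differentiable_inv (f : C -> C) :
  (forall z, in_disk z -> f z <> 0) -> twice_differentiable f ->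
  twice_differentiable (fun z => / f z).
Proof.
  intros Nf Hf; pose proof (twice_differentiable_analytic f Hf) as Af.
  destruct Hf as [f1 [Df Af1]].
  exists (fun z => f1 z * ((- (1)) * (/ f z * / f z))); split.
  - intros z Hz; pose proof (Nf z Hz).
    eapply is_Cderive_of_eq.
    + apply (is_Cderive_comp Cinv f); [now apply is_Cderive_inv, Nf|now apply Df].
    + field; auto.
  - pose proof (analytic_inv f Nf Af).
    apply analytic_mult; [exact Af1|].
    apply (analytic_mult (fun _ => - (1)) (fun z => / f z * / f z)); [apply analytic_const|].
    now apply analytic_mult.
Qed.

Lemma twice_differentiable_cexp (f : C -> C) :
  twice_differentiable f -> twice_differentiable (fun z => cexp (f z)).
Proof.
  intros Hf; pose proof (twice_differentiable_analytic f Hf) as Af.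
  destruct Hf as [f1 [Df Af1]].
  exists (fun z => f1 z * cexp (f z)); split.
  - intros z Hz; apply is_Cderive_comp; [apply is_Cderive_cexp|now apply Df].
  - apply analytic_mult; [exact Af1|now apply analytic_cexp].
Qed.

(** Multiplying f by the unimodular constant conj(f 0)/|f 0| makes its central value equal to |f 0|,
    so the bound for real parts applies. *)
Lemma Cmod_center_le_circle (f : C -> C) (r M : R) :
  twice_differentiable f -> (0 < r < 1)%R ->
  (forall t, Cmod (f (polar r t)) <= M)%R -> (Cmod (f 0) <= M)%R.
Proof.
  intros Hf Hr HM.
  destruct (Ceq_dec (f 0) 0) as [E|N].
  { rewrite E, Cmod_0; eapply Rle_trans; [apply Cmod_ge_0|apply (HM 0%R)]. }
  assert (P : (0 < Cmod (f 0))%R) by now apply Cmod_gt_0.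
  assert (PC : RtoC (Cmod (f 0)) <> 0) by (intros H; apply RtoC_inj in H; lra).
  set (u := Cconj (f 0) / RtoC (Cmod (f 0))).
  assert (Hu : Cmod u = 1%R).
  { unfold u; rewrite Cmod_div, Cmod_conj, Cmod_R, Rabs_pos_eq by (auto; lra). field; lra. }
  assert (Eu : u * f 0 = RtoC (Cmod (f 0))).
  { unfold u. transitivity (f 0 * Cconj (f 0) / RtoC (Cmod (f 0))); [field; auto|].
    rewrite <- Cmod2_conj, RtoC_pow; field; auto. }
  destruct (twice_differentiable_mult _ f (twice_differentiable_const u) Hf) as [g1 [Dg Ag]].
  replace (Cmod (f 0)) with (fst (u * f 0)) by now rewrite Eu.
  apply (re_center_le_circle (fun z => u * f z) g1 Dg Ag r M Hr); intros t.
  eapply Rle_trans; [apply Rle_abs|]. eapply Rle_trans; [apply Rabs_fst_le_Cmod|].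
  rewrite Cmod_mult, Hu, Rmult_1_l; apply HM.
Qed.

(** * Complex power series *)

Lemma is_Cseries_unique (c : nat -> C) (l l' : C) : is_Cseries c l -> is_Cseries c l' -> l = l'.
Proof. apply (filterlim_locally_unique (V := C_NormedModule)). Qed.

Lemma is_Cseries_ext (c d : nat -> C) (l : C) :
  (forall k, c k = d k) -> is_Cseries c l -> is_Cseries d l.
Proof. apply (is_series_ext (K := C_AbsRing) (V := C_NormedModule)). Qed.

Lemma is_Cseries_minus (c d : nat -> C) (l l' : C) :
  is_Cseries c l -> is_Cseries d l' -> is_Cseries (fun k => c k - d k) (l - l').
Proof. apply (is_series_minus (K := C_AbsRing) (V := C_NormedModule)). Qed.

Lemma is_Cseries_scal (a : C) (c : nat -> C) (l : C) :
  is_Cseries c l -> is_Cseries (fun k => a * c k) (a * l).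
Proof. apply (is_series_scal_l (K := C_AbsRing) (V := C_NormedModule)). Qed.

Lemma is_Cseries_decr_1 (c : nat -> C) (l : C) :
  is_Cseries (fun k => c (S k)) (l - c O) -> is_Cseries c l.
Proof. apply (is_series_decr_1 (K := C_AbsRing) (V := C_NormedModule)). Qed.

Definition Csum (c : nat -> C) (n : nat) : C := @sum_n C_AbelianMonoid c n.

Lemma Csum_0 (c : nat -> C) : Csum c 0 = c O.
Proof. apply sum_O. Qed.

Lemma Csum_S (c : nat -> C) (n : nat) : Csum c (S n) = Csum c n + c (S n).
Proof. apply (sum_Sn (G := C_AbelianMonoid)). Qed.

Lemma fst_Csum (c : nat -> C) (n : nat) : fst (Csum c n) = sum_n (fun k => fst (c k)) n.
Proof.
  induction n; [now rewrite Csum_0, sum_O|].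
  now rewrite Csum_S, sum_Sn, <- IHn.
Qed.

Lemma snd_Csum (c : nat -> C) (n : nat) : snd (Csum c n) = sum_n (fun k => snd (c k)) n.
Proof.
  induction n; [now rewrite Csum_0, sum_O|].
  now rewrite Csum_S, sum_Sn, <- IHn.
Qed.

(** Comparison tests and Cauchy products of real series reach complex series through this
    equivalence. *)
Lemma is_Cseries_components (c : nat -> C) (l : C) :
  is_Cseries c l <->
  is_series (fun k => fst (c k)) (fst l) /\ is_series (fun k => snd (c k)) (snd l).
Proof.
  split.
  - intros H; split.
    + apply (filterlim_ext (fun n => fst (Csum c n))); [intros n; apply fst_Csum|].
      apply (filterlim_comp _ _ _ (Csum c) (fun z : C => fst z) _ (locally l)); [exact H|].
      destruct l; apply (continuous_fst (U := R_UniformSpace) (V := R_UniformSpace)).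
    + apply (filterlim_ext (fun n => snd (Csum c n))); [intros n; apply snd_Csum|].
      apply (filterlim_comp _ _ _ (Csum c) (fun z : C => snd z) _ (locally l)); [exact H|].
      destruct l; apply (continuous_snd (U := R_UniformSpace) (V := R_UniformSpace)).
  - intros [H1 H2].
    apply (proj2 (filterlim_locally (U := C_UniformSpace) (Csum c) l)); intros eps.
    pose proof (proj1 (filterlim_locally _ _) H1 eps) as E1.
    pose proof (proj1 (filterlim_locally _ _) H2 eps) as E2.
    generalize (filter_and _ _ E1 E2); apply filter_imp.
    intros n [A1 A2]; split.
    + now rewrite fst_Csum.
    + now rewrite snd_Csum.
Qed.

Lemma Cmod_series_le (c : nat -> C) (d : nat -> R) (l : C) (D : R) :
  (forall k, Cmod (c k) <= d k)%R -> is_Cseries c l -> is_series d D -> (Cmod l <= D)%R.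
Proof.
  intros Hle Hc Hd.
  assert (Hn : forall n, (Cmod (Csum c n) <= sum_n d n)%R).
  { induction n; [rewrite Csum_0, sum_O; apply Hle|].
    rewrite Csum_S, sum_Sn. eapply Rle_trans; [apply Cmod_triangle|].
    apply Rplus_le_compat; [exact IHn|apply Hle]. }
  apply (is_lim_seq_le (fun n => Cmod (Csum c n)) (sum_n d) (Cmod l) D Hn).
  - apply (filterlim_comp _ _ _ (Csum c) Cmod _ (locally l)); [exact Hc|].
    apply (filterlim_norm (K := C_AbsRing) (V := C_NormedModule)).
  - exact Hd.
Qed.

(** Radius of convergence at least one. *)
Definition abs_conv (b : nat -> C) : Prop :=
  forall r : R, (0 <= r < 1)%R -> ex_series (fun k => Cmod (b k) * r ^ k)%R.

Definition psum (b : nat -> C) (z : C) : C :=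
  (Series (fun k => fst (b k * z ^ k)), Series (fun k => snd (b k * z ^ k))).

Lemma ex_series_Rle (a d : nat -> R) :
  (forall k, Rabs (a k) <= d k)%R -> ex_series d -> ex_series a.
Proof. apply (ex_series_le (K := R_AbsRing) (V := R_CompleteNormedModule)). Qed.

Lemma psum_correct (b : nat -> C) (z : C) :
  abs_conv b -> in_disk z -> is_Cseries (fun k => b k * z ^ k) (psum b z).
Proof.
  intros Hb Hz; specialize (Hb (Cmod z) (conj (Cmod_ge_0 z) Hz)).
  apply is_Cseries_components; split; apply Series_correct;
    (apply (ex_series_Rle _ (fun k => Cmod (b k) * Cmod z ^ k)%R); [intros k|exact Hb]);
    rewrite <- Cmod_pow, <- Cmod_mult; [apply Rabs_fst_le_Cmod|apply Rabs_snd_le_Cmod].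
Qed.

Lemma is_pseries_iff (b : nat -> C) (z l : C) :
  @is_pseries C_AbsRing C_NormedModule b z l <-> is_Cseries (fun k => b k * z ^ k) l.
Proof.
  split; apply is_Cseries_ext; intros k; apply Cmult_comm.
Qed.

(** Abel's argument: convergence at a point p between r and 1 bounds the partial sums by M, hence
    the terms by 2M, and the terms at r are then dominated by a geometric series of ratio r/p. *)
Lemma abs_conv_of_pseries (b : nat -> C) (f : C -> C) :
  (forall z, in_disk z -> @is_pseries C_AbsRing C_NormedModule b z (f z)) -> abs_conv b.
Proof.
  intros H r Hr.
  set (p := ((1 + r) / 2)%R).
  assert (Hp : (0 < p < 1)%R) by (unfold p; lra).
  assert (Hz : in_disk (RtoC p)) by (unfold in_disk; rewrite Cmod_R, Rabs_pos_eq; lra).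
  specialize (H _ Hz); apply is_pseries_iff in H.
  set (c := fun k => b k * RtoC p ^ k) in *.
  destruct (filterlim_bounded (K := C_AbsRing) (V := C_NormedModule) (Csum c)
    (ex_intro _ _ H)) as [M HM].
  change (forall n, Cmod (Csum c n) <= M)%R in HM.
  assert (HT : forall k, (Cmod (b k) * p ^ k <= 2 * M)%R).
  { intros k.
    replace (Cmod (b k) * p ^ k)%R with (Cmod (c k)).
    2:{ unfold c; now rewrite Cmod_mult, Cmod_pow, Cmod_R, Rabs_pos_eq by lra. }
    pose proof (Rle_trans _ _ _ (Cmod_ge_0 _) (HM O)).
    destruct k.
    - specialize (HM O); rewrite Csum_0 in HM; lra.
    - replace (c (S k)) with (Csum c (S k) - Csum c k) by (rewrite Csum_S; ring).
      eapply Rle_trans; [apply Cmod_triangle|]. rewrite Cmod_opp.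
      pose proof (HM k); pose proof (HM (S k)); lra. }
  apply (ex_series_Rle _ (fun k => 2 * M * (r / p) ^ k)%R).
  - intros k.
    assert (0 <= r ^ k)%R by (apply pow_le; lra).
    assert (0 < p ^ k)%R by (apply pow_lt; lra).
    pose proof (Cmod_ge_0 (b k)).
    rewrite Rabs_pos_eq by now apply Rmult_le_pos.
    replace ((r / p) ^ k)%R with (r ^ k / p ^ k)%R by (unfold Rdiv; now rewrite Rpow_mult_distr, pow_inv).
    replace (Cmod (b k) * r ^ k)%R with (Cmod (b k) * p ^ k * (r ^ k / p ^ k))%R by (field; lra).
    apply Rmult_le_compat_r; [apply Rdiv_le_0_compat; lra|apply HT].
  - apply (ex_series_scal_l (K := R_AbsRing) (V := R_NormedModule) (2 * M)%R).
    apply ex_series_geom.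
    rewrite Rabs_pos_eq by (apply Rdiv_le_0_compat; lra).
    apply Rmult_lt_reg_r with p; [lra|]. unfold Rdiv; rewrite Rmult_assoc, Rinv_l by lra.
    unfold p; lra.
Qed.

Lemma psum_of_pseries (b : nat -> C) (f : C -> C) :
  (forall z, in_disk z -> @is_pseries C_AbsRing C_NormedModule b z (f z)) ->
  forall z, in_disk z -> f z = psum b z.
Proof.
  intros H z Hz; apply (is_Cseries_unique (fun k => b k * z ^ k)).
  - now apply is_pseries_iff, H.
  - apply psum_correct; [exact (abs_conv_of_pseries b f H)|exact Hz].
Qed.

(** The derivative of z^k. At k = 0 the truncated [pred] is harmless because the factor in front is
    0. *)
Definition dpow (z : C) (k : nat) : C := RtoC (INR k) * z ^ pred k.

Lemma dpow_S (z : C) (k : nat) : dpow z (S k) = z * dpow z k + z ^ k.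
Proof.
  unfold dpow; rewrite S_INR, RtoC_plus; simpl pred.
  destruct k; simpl; ring.
Qed.

Lemma Cmod_dpow (z : C) (k : nat) : Cmod (dpow z k) = (INR k * Cmod z ^ pred k)%R.
Proof. unfold dpow; rewrite Cmod_mult, Cmod_pow, Cmod_R, Rabs_pos_eq; auto using pos_INR. Qed.

Lemma Rdpow_S (m : R) (k : nat) :
  (INR (S k) * m ^ pred (S k) = m * (INR k * m ^ pred k) + m ^ k)%R.
Proof. rewrite S_INR; simpl pred; destruct k; simpl; ring. Qed.

(* Comparing binomial expansions termwise: [|h|^j <= (|h|/t)^2 t^j] for [j >= 2]. *)
Lemma pow_increment_bound (z h : C) (t : R) (k : nat) :
  (0 < t)%R -> (Cmod h <= t)%R ->
  (Cmod ((z + h) ^ k - z ^ k - h * dpow z k)%C <=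
   (Cmod h / t) ^ 2 *
     ((Cmod z + t) ^ k - Cmod z ^ k - t * (INR k * Cmod z ^ pred k)))%R.
Proof.
  intros Ht Hh; set (m := Cmod z); set (q := (Cmod h / t)%R).
  assert (Hq : Cmod h = (q * t)%R) by (unfold q; field; lra).
  assert (Pm : (0 <= m)%R) by apply Cmod_ge_0.
  assert (Pq : (0 <= q)%R) by (apply Rdiv_le_0_compat; [apply Cmod_ge_0|easy]).
  induction k.
  - simpl. replace (1 - 1 - h * dpow z 0) with (RtoC 0) by (unfold dpow; simpl; ring).
    rewrite Cmod_0. apply Req_le; ring.
  - rewrite dpow_S, Rdpow_S.
    replace ((z + h) ^ S k - z ^ S k - h * (z * dpow z k + z ^ k))
      with ((z + h) * ((z + h) ^ k - z ^ k - h * dpow z k) + h * h * dpow z k) by (simpl; ring).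
    eapply Rle_trans; [apply Cmod_triangle|].
    rewrite !Cmod_mult, Cmod_dpow; fold m.
    set (E := Cmod ((z + h) ^ k - z ^ k - h * dpow z k)%C) in *.
    assert (0 <= E)%R by apply Cmod_ge_0.
    assert (Cmod (z + h)%C <= m + t)%R.
    { eapply Rle_trans; [apply Cmod_triangle|]. fold m; lra. }
    assert (Cmod (z + h)%C * E <= (m + t) * (q ^ 2 * ((m + t) ^ k - m ^ k - t * (INR k * m ^ pred k))))%R.
    { apply Rmult_le_compat; auto using Cmod_ge_0. }
    rewrite Hq, <- (tech_pow_Rmult (m + t)), <- (tech_pow_Rmult m).
    eapply Rle_trans; [apply Rplus_le_compat_r; eassumption|].
    apply Req_le; ring.
Qed.

(** The left side is one term of the binomial expansion of the right side. *)
Lemma Rdpow_bound (m t : R) (k : nat) :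
  (0 <= m)%R -> (0 < t)%R -> (t * (INR k * m ^ pred k) <= (m + t) ^ k)%R.
Proof.
  intros Hm Ht; induction k; [simpl; lra|].
  rewrite Rdpow_S.
  assert (m ^ k <= (m + t) ^ k)%R by (apply pow_incr; lra).
  rewrite <- tech_pow_Rmult. nra.
Qed.

Definition dcoef (b : nat -> C) (k : nat) : C := RtoC (INR (S k)) * b (S k).

(** A slightly larger radius absorbs the factor: (k + 1) r^k <= (r + t)^(k + 1) / t, with t half the
    distance from r to 1. *)
Lemma abs_conv_dcoef (b : nat -> C) : abs_conv b -> abs_conv (dcoef b).
Proof.
  intros Hb r Hr; set (t := ((1 - r) / 2)%R).
  assert (Ht : (0 < t)%R) by (unfold t; lra).
  assert (Hrt : (0 <= r + t < 1)%R) by (unfold t; lra).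
  specialize (Hb _ Hrt).
  apply (ex_series_Rle _ (fun k => / t * (Cmod (b (S k)) * (r + t) ^ S k))%R).
  - intros k; unfold dcoef; rewrite Cmod_mult, Cmod_R, (Rabs_pos_eq (INR _)) by apply pos_INR.
    pose proof (Rdpow_bound r t (S k) (proj1 Hr) Ht) as B; simpl pred in B.
    assert (0 <= INR (S k))%R by apply pos_INR.
    assert (0 <= r ^ k)%R by (apply pow_le; lra).
    pose proof (Cmod_ge_0 (b (S k))).
    rewrite Rabs_pos_eq by (repeat apply Rmult_le_pos; auto).
    apply (Rmult_le_reg_l t); [easy|].
    rewrite <- (Rmult_assoc t (/ t)), Rinv_r, Rmult_1_l by lra.
    replace (t * (INR (S k) * Cmod (b (S k)) * r ^ k))%R
      with (Cmod (b (S k)) * (t * (INR (S k) * r ^ k)))%R by ring.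
    now apply Rmult_le_compat_l.
  - apply (ex_series_scal_l (K := R_AbsRing) (V := R_NormedModule) (/ t)%R).
    now apply (ex_series_incr_1 (fun k => Cmod (b k) * (r + t) ^ k)%R) in Hb.
Qed.

(** Summing the termwise estimates bounds the remainder by (|h|/t)^2 times the sum of |b_k| (|z| +
    t)^k, which is finite as t is half the distance from z to the unit circle. *)
Lemma is_Cderive_psum (b : nat -> C) (z : C) :
  abs_conv b -> in_disk z -> is_Cderive (psum b) z (psum (dcoef b) z).
Proof.
  intros Hb Hz; set (m := Cmod z); set (t := ((1 - m) / 2)%R).
  assert (Hm : (0 <= m < 1)%R) by (split; [apply Cmod_ge_0|exact Hz]).
  assert (Ht : (0 < t)%R) by (unfold t; lra).
  assert (Hmt : (0 <= m + t < 1)%R) by (unfold t; lra).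
  set (K := Series (fun k => Cmod (b k) * (m + t) ^ k)%R).
  assert (HK : is_series (fun k => Cmod (b k) * (m + t) ^ k)%R K) by now apply Series_correct, Hb.
  assert (PK : (0 <= K)%R).
  { eapply Rle_trans; [apply (Cmod_ge_0 (psum b z))|].
    apply (Cmod_series_le (fun k => b k * z ^ k) _ _ _) with (2 := psum_correct b z Hb Hz) (3 := HK).
    intros k; rewrite Cmod_mult, Cmod_pow; fold m.
    apply Rmult_le_compat_l; [apply Cmod_ge_0|apply pow_incr; lra]. }
  apply (is_Cderive_quadratic _ _ _ t (K / t ^ 2) Ht).
  { apply Rdiv_le_0_compat; [exact PK|now apply pow_lt]. }
  intros h Hh.
  assert (Hzh : in_disk (z + h)).
  { unfold in_disk; eapply Rle_lt_trans; [apply Cmod_triangle|]. fold m; lra. }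
  assert (HD : is_Cseries (fun k => b k * dpow z k) (psum (dcoef b) z)).
  { apply is_Cseries_decr_1.
    replace (psum (dcoef b) z - b O * dpow z 0) with (psum (dcoef b) z) by (unfold dpow; simpl; ring).
    apply (is_Cseries_ext (fun k => dcoef b k * z ^ k)).
    - intros k; unfold dcoef, dpow; simpl pred; ring.
    - apply psum_correct; [now apply abs_conv_dcoef|exact Hz]. }
  pose proof (is_Cseries_minus _ _ _ _ (is_Cseries_minus _ _ _ _ (psum_correct b _ Hb Hzh)
    (psum_correct b _ Hb Hz)) (is_Cseries_scal h _ _ HD)) as HS.
  rewrite (Cmult_comm (psum (dcoef b) z)).
  replace (K / t ^ 2 * Cmod h ^ 2)%R with ((Cmod h / t) ^ 2 * K)%R by (field; lra).
  apply (Cmod_series_le _ (fun k => (Cmod h / t) ^ 2 * (Cmod (b k) * (m + t) ^ k))%R _ _) with (2 := HS).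
  - intros k.
    replace (b k * (z + h) ^ k - b k * z ^ k - h * (b k * dpow z k))
      with (b k * ((z + h) ^ k - z ^ k - h * dpow z k)) by ring.
    rewrite Cmod_mult.
    pose proof (pow_increment_bound z h t k Ht (Rlt_le _ _ Hh)) as B; fold m in B.
    assert (0 <= m ^ k)%R by (apply pow_le; lra).
    assert (0 <= t * (INR k * m ^ pred k))%R.
    { apply Rmult_le_pos; [lra|apply Rmult_le_pos; [apply pos_INR|apply pow_le; lra]]. }
    assert (0 <= (Cmod h / t) ^ 2)%R by apply pow2_ge_0.
    pose proof (Cmod_ge_0 (b k)).
    assert (Cmod ((z + h) ^ k - z ^ k - h * dpow z k)%C <= (Cmod h / t) ^ 2 * (m + t) ^ k)%R by nra.
    replace ((Cmod h / t) ^ 2 * (Cmod (b k) * (m + t) ^ k))%R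
      with (Cmod (b k) * ((Cmod h / t) ^ 2 * (m + t) ^ k))%R by ring.
    now apply Rmult_le_compat_l.
  - now apply (is_series_scal_l (K := R_AbsRing) (V := R_NormedModule) ((Cmod h / t) ^ 2)%R).
Qed.

Lemma twice_differentiable_psum (b : nat -> C) : abs_conv b -> twice_differentiable (psum b).
Proof.
  intros Hb; exists (psum (dcoef b)); split.
  - intros z Hz; now apply is_Cderive_psum.
  - intros z Hz; exists (psum (dcoef (dcoef b)) z).
    apply is_Cderive_psum; [now apply abs_conv_dcoef|exact Hz].
Qed.

Lemma abs_conv_shift (b : nat -> C) : abs_conv b -> abs_conv (fun k => b (S k)).
Proof.
  intros Hb r Hr; eapply ex_series_Rle; [|exact (abs_conv_dcoef b Hb r Hr)].
  intros k; unfold dcoef; rewrite Cmod_mult, Cmod_R, (Rabs_pos_eq (INR _)) by apply pos_INR.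
  assert (0 <= r ^ k)%R by (apply pow_le; lra).
  pose proof (Cmod_ge_0 (b (S k))); pose proof (pos_INR k).
  rewrite Rabs_pos_eq by now apply Rmult_le_pos.
  apply Rmult_le_compat_r; [easy|]. rewrite S_INR; nra.
Qed.

Lemma psum_shift (b : nat -> C) (z : C) :
  abs_conv b -> in_disk z -> psum b z = b O + z * psum (fun k => b (S k)) z.
Proof.
  intros Hb Hz.
  apply (is_Cseries_unique (fun k => b k * z ^ k)); [now apply psum_correct|].
  apply is_Cseries_decr_1.
  replace (b O + z * psum (fun k => b (S k)) z - b O * z ^ 0)
    with (z * psum (fun k => b (S k)) z) by (simpl; ring).
  apply (is_Cseries_ext (fun k => z * (b (S k) * z ^ k))); [intros k; simpl; ring|].
  apply is_Cseries_scal, (psum_correct (fun k => b (S k))); [now apply abs_conv_shift|exact Hz].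
Qed.

Lemma psum_at_0 (b : nat -> C) : abs_conv b -> psum b 0 = b O.
Proof. intros Hb; rewrite (psum_shift b 0 Hb in_disk_0); ring. Qed.

(** Induction with b generalised: the differentiated series vanishes as well, and its n-th
    coefficient is n + 1 times [b (S n)]. *)
Lemma psum_zero_coef (b : nat -> C) :
  abs_conv b -> (forall z, in_disk z -> psum b z = 0) -> forall n, b n = 0.
Proof.
  intros Hb H n; revert b Hb H; induction n; intros b Hb H.
  - rewrite <- psum_at_0 by exact Hb; apply H, in_disk_0.
  - assert (E : dcoef b n = 0).
    { apply IHn; [now apply abs_conv_dcoef|].
      intros z Hz; apply (is_Cderive_unique (psum b) z); [now apply is_Cderive_psum|].
      apply (is_Cderive_ext_disk (fun _ => 0)); [|exact Hz|apply is_Cderive_const].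
      intros x Hx; now rewrite H. }
    destruct (Ceq_dec (b (S n)) 0) as [|N]; [easy|exfalso].
    revert E; apply Cmult_neq_0; [|exact N].
    intros E; apply RtoC_inj in E; apply not_0_INR in E; [easy|lia].
Qed.

(** * The bound *)

(* On [|w| < 1] the map [w |-> w e^w] has derivative [(1 + w) e^w <> 0], so [w'] is
   as regular as the derivative of [w e^w]. *)
Lemma twice_differentiable_of_mul_cexp (w Q : C -> C) :
  analytic_on_disk w -> (forall z, in_disk z -> in_disk (w z)) ->
  twice_differentiable Q -> (forall z, in_disk z -> w z * cexp (w z) = Q z) ->
  twice_differentiable w.
Proof.
  intros Aw Dw [Q1 [HQ AQ]] E.
  assert (N : forall z, in_disk z -> (1 + w z) * cexp (w z) <> 0).
  { intros z Hz; apply Cmult_neq_0; [|apply cexp_neq_0].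
    intros H; specialize (Dw z Hz); unfold in_disk in Dw.
    replace (w z) with (- (1)) in Dw; [rewrite Cmod_m1 in Dw; lra|].
    transitivity (1 + w z - 1); [rewrite H|]; ring. }
  exists (fun z => Q1 z * / ((1 + w z) * cexp (w z))); split.
  - intros z Hz; destruct (Aw z Hz) as [l Hl].
    apply (is_Cderive_of_eq w z l); [exact Hl|].
    assert (H : is_Cderive Q z (l * cexp (w z) + w z * (l * cexp (w z)))).
    { apply (is_Cderive_ext_disk (fun z => w z * cexp (w z))); auto.
      apply (is_Cderive_mult w (fun z => cexp (w z))); [exact Hl|].
      apply (is_Cderive_comp cexp w); [apply is_Cderive_cexp|exact Hl]. }
    rewrite (is_Cderive_unique Q z _ _ (HQ z Hz) H).
    change (l = (l * cexp (w z) + w z * (l * cexp (w z))) * / ((1 + w z) * cexp (w z)) :> C).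
    specialize (N z Hz); set (l' := l : C); field; split; [apply cexp_neq_0|].
    intros Z; apply N; rewrite Z; ring.
  - apply analytic_mult; [exact AQ|apply analytic_inv; [exact N|]].
    apply analytic_mult; [|now apply analytic_cexp].
    apply (analytic_plus (fun _ => 1) w); [apply analytic_const|exact Aw].
Qed.

Lemma le_one_of_cube (c : R) : (forall r, 0 < r < 1 -> c <= 1 / r ^ 3)%R -> (c <= 1)%R.
Proof.
  intros H; destruct (Rle_lt_dec c 1) as [|Hc]; [easy|exfalso].
  (* Chosen so that 3 c s = (c - 1)/2. Then c (1 - s)^3 >= c (1 - 3 s) = (c + 1)/2 > 1, against the
     hypothesis at r = 1 - s. *)
  set (s := ((c - 1) / (6 * c))%R).
  assert (Es : (6 * (c * s) = c - 1)%R) by (unfold s; field; lra).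
  assert (Hs : (0 < s < 1)%R) by (split; nra).
  specialize (H (1 - s)%R ltac:(lra)).
  assert (0 < (1 - s) ^ 3)%R by (apply pow_lt; lra).
  apply (Rmult_le_compat_r ((1 - s) ^ 3)) in H; [|lra].
  replace (1 / (1 - s) ^ 3 * (1 - s) ^ 3)%R with 1%R in H by (field; lra).
  assert (1 - 3 * s <= (1 - s) ^ 3)%R by nra.
  nra.
Qed.

(** Since |w| < 1, the function G is bounded by 1/r^3 on |z| = r, hence also at the centre, for
    every r < 1. *)
Lemma schwarz_order_three (w G : C -> C) :
  schwarz w -> twice_differentiable G ->
  (forall z, in_disk z -> w z = z * z * z * G z) -> (Cmod (G 0) <= 1)%R.
Proof.
  intros [_ [_ Dw]] HG E; apply le_one_of_cube; intros r Hr.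
  apply (Cmod_center_le_circle G r _ HG Hr); intros t.
  assert (Hz : in_disk (polar r t)) by (apply in_disk_polar; rewrite Rabs_pos_eq; lra).
  pose proof (Dw _ Hz) as H; unfold in_disk in H.
  rewrite (E _ Hz), !Cmod_mult, Cmod_polar, Rabs_pos_eq in H by lra.
  assert (0 < r ^ 3)%R by (apply pow_lt; lra).
  apply (Rmult_le_reg_l (r ^ 3)); [easy|].
  replace (r ^ 3 * (1 / r ^ 3))%R with 1%R by (field; lra).
  replace (r ^ 3 * Cmod (G (polar r t)))%R with (r * r * r * Cmod (G (polar r t)))%R by ring.
  now apply Rlt_le.
Qed.

Lemma in_S_wp_b4_bound (f : C -> C) (b : nat -> C) :
  in_S_wp f b -> b 2%nat = 0 -> b 3%nat = 0 -> (Cmod (b 4%nat) <= 1 / 3)%R.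
Proof.
  intros [[Hf [B0 B1]] [w [Sw Hw]]] B2 B3.
  pose proof (abs_conv_of_pseries b f Hf) as Hb.
  pose proof (psum_of_pseries b f Hf) as Ef.
  set (u := fun k => b (S k)).
  assert (Hu : abs_conv u) by now apply abs_conv_shift.
  set (U := psum u).
  assert (EU : forall z, in_disk z -> z * U z = f z).
  { intros z Hz; rewrite Ef, psum_shift, B0 by assumption; unfold U, u; ring. }
  assert (U0 : U 0 = 1) by (unfold U; rewrite psum_at_0 by exact Hu; exact B1).
  assert (NU : forall z, in_disk z -> U z <> 0).
  { intros z Hz; destruct (Ceq_dec z 0) as [->|Nz]; [rewrite U0; apply C1_nz|].
    intros H; apply (Hw z Hz Nz); rewrite <- EU, H by exact Hz; ring. }
  (* The coefficients of U' are b_2, 2 b_3, 3 b_4, and so on. The first two vanish, so dropping them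
     extracts the factor z^2. *)
  set (t := fun k => dcoef u (S (S k))).
  assert (Hd : abs_conv (fun k => dcoef u (S k))) by now apply (abs_conv_shift (dcoef u)), abs_conv_dcoef.
  assert (Ht : abs_conv t) by exact (abs_conv_shift _ Hd).
  set (T := psum t).
  assert (T0 : T 0 = 3 * b 4%nat).
  { unfold T; rewrite psum_at_0 by exact Ht; unfold t, dcoef, u; simpl INR.
    replace (RtoC (1 + 1 + 1)) with (RtoC 3) by (f_equal; ring). reflexivity. }
  assert (EU1 : forall z, in_disk z -> psum (dcoef u) z = z * z * T z).
  { intros z Hz; rewrite psum_shift by (auto using abs_conv_dcoef).
    rewrite (psum_shift (fun k => dcoef u (S k))) by assumption.
    fold t T; unfold dcoef, u; rewrite B2, B3; unfold T; ring. }
  set (q := fun z => T z * / U z).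
  assert (Hq : twice_differentiable q).
  { apply twice_differentiable_mult; [now apply twice_differentiable_psum|].
    apply twice_differentiable_inv; [exact NU|now apply twice_differentiable_psum]. }
  assert (Ew : forall z, in_disk z -> w z * cexp (w z) = z * z * z * q z).
  (* The subordination identity excludes the centre, where [w 0 = 0] takes over. *)
  { intros z Hz; destruct (Ceq_dec z 0) as [->|Nz].
    - destruct Sw as [_ [-> _]]; ring.
    - destruct (Hw z Hz Nz) as [Nf [l [Hl El]]].
      assert (L : l = 1 * U z + z * psum (dcoef u) z).
      { apply (is_Cderive_unique f z); [exact Hl|].
        apply (is_Cderive_ext_disk (fun z => z * U z)); [exact EU|exact Hz|].
        apply (is_Cderive_mult (fun z => z) U); [apply is_Cderive_id|now apply is_Cderive_psum]. }
      unfold wp in El; rewrite L, EU1, <- EU in El by exact Hz.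
      pose proof (NU z Hz).
      transitivity (1 + w z * cexp (w z) - 1); [ring|]. rewrite <- El.
      unfold q; field; auto. }
  assert (Tw : twice_differentiable w).
  { destruct Sw as [Aw [_ Dw]].
    apply (twice_differentiable_of_mul_cexp w (fun z => z * z * z * q z)); auto.
    apply (twice_differentiable_mult (fun z => z * z * z) q); [|exact Hq].
    apply (twice_differentiable_mult (fun z => z * z) (fun z => z)); [|apply twice_differentiable_id].
    apply (twice_differentiable_mult (fun z => z) (fun z => z)); apply twice_differentiable_id. }
  (* Writing the exponent as a product with the constant -1 lets the closure of
     [twice_differentiable] under products cover it. *)
  assert (HB : (Cmod (cexp (- 1 * w 0) * q 0) <= 1)%R).
  { apply (schwarz_order_three w (fun z => cexp (- 1 * w z) * q z) Sw).
    - apply (twice_differentiable_mult (fun z => cexp (- 1 * w z)) q); [|exact Hq].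
      apply (twice_differentiable_cexp (fun z => - 1 * w z)).
      apply (twice_differentiable_mult (fun _ => - 1) w); [apply twice_differentiable_const|exact Tw].
    - intros z Hz.
      transitivity (cexp (- 1 * w z) * (z * z * z * q z)); [|ring].
      rewrite <- Ew by exact Hz.
      transitivity (w z * (cexp (- 1 * w z) * cexp (w z))); [|ring].
      replace (- 1 * w z) with (- w z) by ring. rewrite cexp_opp_l; ring. }
  unfold q in HB; rewrite T0, U0 in HB; destruct Sw as [_ [W0 _]]; rewrite W0 in HB.
  replace (- 1 * 0) with (RtoC 0) in HB by ring. rewrite cexp_0 in HB.
  replace (1 * (3 * b 4%nat * / 1)) with (3 * b 4%nat) in HB by field.
  rewrite Cmod_mult, Cmod_R, Rabs_pos_eq in HB; lra.
Qed.

(** * The primitive cube root of unity and three-fold symmetry *)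

Lemma eps3_eq : eps3 = (-1 / 2, sqrt 3 / 2)%R.
Proof.
  unfold eps3; replace (2 * PI / 3)%R with (2 * (PI / 3))%R by field.
  now rewrite cos_2PI3, sin_2PI3.
Qed.

Lemma eps3_cube : eps3 * eps3 * eps3 = 1.
Proof.
  rewrite eps3_eq; unfold Cmult, RtoC; simpl.
  pose proof (sqrt_sqrt 3 ltac:(lra)) as H.
  set (s := sqrt 3) in *; f_equal.
  - transitivity ((3 * (s * s) - 1) / 8)%R; [field|rewrite H; field].
  - transitivity (s * (3 - s * s) / 8)%R; [field|rewrite H; field].
Qed.

Lemma Cmod_eps3 : Cmod eps3 = 1%R.
Proof.
  pose proof (f_equal Cmod eps3_cube) as H; rewrite !Cmod_mult, Cmod_1 in H.
  pose proof (Cmod_ge_0 eps3); nra.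
Qed.

Lemma eps3_neq_1 : eps3 <> 1.
Proof. rewrite eps3_eq; intros H; apply (f_equal fst) in H; simpl in H; lra. Qed.

(** These are the coefficients of f(eps z) - eps f(z), which vanishes on the disk. The new factor
    has modulus at most 2, so absolute convergence persists. *)
Lemma three_fold_coef (f : C -> C) (b : nat -> C) :
  (forall z, in_disk z -> @is_pseries C_AbsRing C_NormedModule b z (f z)) ->
  three_fold_symmetric f -> forall n, b n * (eps3 ^ n - eps3) = 0.
Proof.
  intros Hf Sf.
  pose proof (abs_conv_of_pseries b f Hf) as Hb.
  pose proof (psum_of_pseries b f Hf) as Ef.
  assert (Hc : abs_conv (fun n => b n * (eps3 ^ n - eps3))).
  { intros r Hr.
    apply (ex_series_Rle _ (fun k => 2 * (Cmod (b k) * r ^ k))%R).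
    - intros k.
      assert (0 <= r ^ k)%R by (apply pow_le; lra).
      assert (Cmod (eps3 ^ k - eps3)%C <= 2)%R.
      { eapply Rle_trans; [apply Cmod_triangle|].
        rewrite Cmod_opp, Cmod_pow, Cmod_eps3, pow1; lra. }
      pose proof (Cmod_ge_0 (b k)); pose proof (Cmod_ge_0 (eps3 ^ k - eps3)).
      rewrite Cmod_mult, Rabs_pos_eq by (repeat apply Rmult_le_pos; auto).
      replace (2 * (Cmod (b k) * r ^ k))%R with (Cmod (b k) * 2 * r ^ k)%R by ring.
      apply Rmult_le_compat_r; [easy|]. now apply Rmult_le_compat_l.
    - now apply (ex_series_scal_l (K := R_AbsRing) (V := R_NormedModule) 2%R), Hb. }
  apply (psum_zero_coef _ Hc); intros z Hz.
  assert (Hez : in_disk (eps3 * z)).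
  { unfold in_disk; now rewrite Cmod_mult, Cmod_eps3, Rmult_1_l. }
  apply (is_Cseries_unique _ _ _ (psum_correct _ z Hc Hz)).
  pose proof (is_Cseries_minus _ _ _ _ (psum_correct b _ Hb Hez)
    (is_Cseries_scal eps3 _ _ (psum_correct b _ Hb Hz))) as H.
  rewrite <- !Ef, (Sf z Hz) in H by assumption.
  replace (eps3 * f z - eps3 * f z) with (RtoC 0) in H by ring.
  apply (is_Cseries_ext _ _ _) with (2 := H).
  intros k; rewrite Cpow_mult_l; ring.
Qed.

Lemma three_fold_H3 (f : C -> C) (b : nat -> C) :
  in_S_wp f b -> three_fold_symmetric f ->
  Cmod (H3 b) = (Cmod (b 4%nat) ^ 2)%R /\ (Cmod (b 4%nat) ^ 2 <= 1 / 9)%R.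
Proof.
  intros Hf Sf.
  pose proof (three_fold_coef f b (proj1 (proj1 Hf)) Sf) as Hc.
  assert (Nz : forall n, eps3 ^ n <> eps3 -> b n = 0).
  { intros n Hn; destruct (Ceq_dec (b n) 0) as [|Nb]; [easy|exfalso].
    apply (Cmult_neq_0 _ _ Nb) with (2 := Hc n).
    intros H; apply Hn; transitivity (eps3 ^ n - eps3 + eps3); [ring|rewrite H; ring]. }
  assert (E0 : eps3 <> 0).
  { intros H; pose proof Cmod_eps3 as M; rewrite H, Cmod_0 in M; lra. }
  (* For n = 2, 3, 5, the equation eps^n = eps would force eps = 1. With these coefficients gone,
     the determinant collapses to -b_4^2. *)
  assert (B2 : b 2%nat = 0).
  { apply Nz; intros H; apply eps3_neq_1.
    transitivity (eps3 ^ 2 / eps3); [field; exact E0|rewrite H; field; exact E0]. }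
  assert (B3 : b 3%nat = 0).
  { apply Nz; intros H; apply eps3_neq_1.
    rewrite <- H, <- eps3_cube; ring. }
  assert (B5 : b 5%nat = 0).
  { apply Nz; intros H; apply eps3_neq_1.
    transitivity (eps3 * eps3 * eps3 * eps3 * eps3 / eps3); [rewrite eps3_cube; field; exact E0|].
    replace (eps3 * eps3 * eps3 * eps3 * eps3) with (eps3 ^ 5) by ring.
    rewrite H; field; exact E0. }
  split.
  - replace (H3 b) with (- (b 4%nat * b 4%nat)) by (unfold H3; rewrite B2, B3, B5; ring).
    rewrite Cmod_opp, Cmod_mult; ring.
  - pose proof (in_S_wp_b4_bound f b Hf B2 B3); pose proof (Cmod_ge_0 (b 4%nat)); nra.
Qed.

(** * The extremal function *)

Lemma abs_conv_bounded (b : nat -> C) (M : R) : (forall k, Cmod (b k) <= M)%R -> abs_conv b.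
Proof.
  intros HM r Hr.
  apply (ex_series_Rle _ (fun k => M * r ^ k)%R).
  - intros k; assert (0 <= r ^ k)%R by (apply pow_le; lra).
    rewrite Rabs_pos_eq by (apply Rmult_le_pos; auto using Cmod_ge_0).
    now apply Rmult_le_compat_r.
  - apply (ex_series_scal_l (K := R_AbsRing) (V := R_NormedModule) M).
    apply ex_series_geom; rewrite Rabs_pos_eq; lra.
Qed.

(** Each component of the product combines two real Cauchy products, whose absolute convergence
    follows from that of the moduli. *)
Lemma is_Cseries_cauchy_product (a b : nat -> C) (la lb : C) :
  is_Cseries a la -> is_Cseries b lb ->
  ex_series (fun n => Cmod (a n)) -> ex_series (fun n => Cmod (b n)) ->
  is_Cseries (fun n => Csum (fun k => a k * b (n - k)%nat) n) (la * lb).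
Proof.
  intros Ha Hb Aa Ab.
  apply is_Cseries_components in Ha; apply is_Cseries_components in Hb.
  destruct Ha as [Ha1 Ha2], Hb as [Hb1 Hb2].
  assert (X : forall c : nat -> C, ex_series (fun n => Cmod (c n)) ->
    ex_series (fun n => Rabs (fst (c n))) /\ ex_series (fun n => Rabs (snd (c n)))).
  { intros c Hc; split; (apply (ex_series_Rle _ (fun n => Cmod (c n))); [|exact Hc]);
      intros k; rewrite Rabs_Rabsolu; [apply Rabs_fst_le_Cmod|apply Rabs_snd_le_Cmod]. }
  destruct (X a Aa) as [Xa1 Xa2], (X b Ab) as [Xb1 Xb2].
  apply is_Cseries_components; split.
  - apply (is_series_ext (fun n => minus
      (sum_f_R0 (fun k => fst (a k) * fst (b (n - k)%nat)) n)%R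
      (sum_f_R0 (fun k => snd (a k) * snd (b (n - k)%nat)) n)%R)).
    + intros n; rewrite fst_Csum, sum_n_Reals; symmetry.
      exact (minus_sum (fun k => fst (a k) * fst (b (n - k)%nat))%R
        (fun k => snd (a k) * snd (b (n - k)%nat))%R n).
    + apply (is_series_minus (K := R_AbsRing) (V := R_NormedModule)
        (fun n => sum_f_R0 (fun k => fst (a k) * fst (b (n - k)%nat)) n)%R
        (fun n => sum_f_R0 (fun k => snd (a k) * snd (b (n - k)%nat)) n)%R);
        [apply (is_series_mult (fun k => fst (a k)) (fun k => fst (b k)))
        |apply (is_series_mult (fun k => snd (a k)) (fun k => snd (b k)))]; assumption.
  - apply (is_series_ext (fun n => plus
      (sum_f_R0 (fun k => fst (a k) * snd (b (n - k)%nat)) n)%R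
      (sum_f_R0 (fun k => snd (a k) * fst (b (n - k)%nat)) n)%R)).
    + intros n; rewrite snd_Csum, sum_n_Reals; symmetry.
      exact (plus_sum (fun k => fst (a k) * snd (b (n - k)%nat))%R
        (fun k => snd (a k) * fst (b (n - k)%nat))%R n).
    + apply (is_series_plus (K := R_AbsRing) (V := R_NormedModule)
        (fun n => sum_f_R0 (fun k => fst (a k) * snd (b (n - k)%nat)) n)%R
        (fun n => sum_f_R0 (fun k => snd (a k) * fst (b (n - k)%nat)) n)%R);
        [apply (is_series_mult (fun k => fst (a k)) (fun k => snd (b k)))
        |apply (is_series_mult (fun k => snd (a k)) (fun k => fst (b k)))]; assumption.
Qed.

Lemma psum_ext (b c : nat -> C) (z : C) : (forall k, b k = c k) -> psum b z = psum c z.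
Proof. intros H; unfold psum; f_equal; apply Series_ext; intros k; now rewrite H. Qed.

Definition exp_coef (k : nat) : C := RtoC (/ INR (fact k)).

Lemma inv_fact_bound (k : nat) : (0 < / INR (fact k) <= 1)%R.
Proof.
  pose proof (INR_fact_lt_0 k); split; [now apply Rinv_0_lt_compat|].
  rewrite <- Rinv_1; apply Rinv_le_contravar; [lra|].
  apply (le_INR 1), lt_O_fact.
Qed.

Lemma abs_conv_exp_coef : abs_conv exp_coef.
Proof.
  apply (abs_conv_bounded _ 1); intros k; pose proof (inv_fact_bound k).
  unfold exp_coef; rewrite Cmod_R, Rabs_pos_eq; lra.
Qed.

(** Both sides solve y' = y with value 1 at 0. *)
Lemma psum_exp_coef (z : C) : in_disk z -> psum exp_coef z = cexp z.
Proof.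
  intros Hz.
  assert (H : psum exp_coef z * cexp (- z) = psum exp_coef 0 * cexp (- 0)).
  { apply (linear_ode_unique (psum exp_coef) (fun z => z) (fun _ => 1)); [| |exact Hz].
    - intros x _; apply is_Cderive_id.
    - intros x Hx; apply (is_Cderive_of_eq _ _ (psum (dcoef exp_coef) x)).
      + apply is_Cderive_psum; [apply abs_conv_exp_coef|exact Hx].
      + rewrite Cmult_1_l; apply psum_ext; intros k.
        unfold dcoef, exp_coef; rewrite <- RtoC_mult; f_equal.
        pose proof (INR_fact_neq_0 k).
        rewrite fact_simpl, mult_INR; field; split; [easy|apply not_0_INR; lia]. }
  rewrite psum_at_0 in H by apply abs_conv_exp_coef.
  replace (- 0) with (RtoC 0) in H by ring; rewrite cexp_0 in H.
  unfold exp_coef at 2 in H; simpl in H; rewrite Rinv_1 in H.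
  transitivity (psum exp_coef z * (cexp (- z) * cexp z)); [rewrite cexp_opp_l; ring|].
  rewrite Cmult_assoc, H; ring.
Qed.

(* [bell_upto n] agrees with the Taylor coefficients of [exp ((e^z - 1) / 3)] up to index
   [n]; the next one comes from comparing coefficients in [3 E' = e^z E]. *)
Fixpoint bell_upto (n : nat) : nat -> R :=
  match n with
  | O => fun _ => 1%R
  | S m => fun k =>
      if Nat.leb k m then bell_upto m k
      else (/ (3 * INR (S m)) *
            sum_f_R0 (fun j => bell_upto m j * / INR (fact (m - j))) m)%R
  end.

(** The Touchard polynomial of degree n at 1/3, divided by n!. *)
Definition bell (n : nat) : R := bell_upto n n.

Lemma bell_upto_eq (n k : nat) : (k <= n)%nat -> bell_upto n k = bell k.
Proof.
  induction n; intros H.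
  - now replace k with O by lia.
  - destruct (Nat.eq_dec k (S n)) as [->|N]; [easy|].
    simpl; rewrite (proj2 (Nat.leb_le k n)) by lia; apply IHn; lia.
Qed.

Lemma bell_S (n : nat) :
  bell (S n) =
  (/ (3 * INR (S n)) * sum_f_R0 (fun j => bell j * / INR (fact (n - j))) n)%R.
Proof.
  unfold bell at 1; cbn -[INR fact Nat.leb].
  rewrite (proj2 (Nat.leb_gt (S n) n)) by lia; f_equal.
  apply sum_eq; intros j Hj; now rewrite bell_upto_eq.
Qed.

(** By strong induction the sum in the recursion has n + 1 terms of modulus at most 1, and it is
    divided by 3 (n + 1). This crude bound already gives convergence on the disk. *)
Lemma bell_bound (n : nat) : (Rabs (bell n) <= 1)%R.
Proof.
  induction n as [n IH] using (well_founded_induction lt_wf).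
  destruct n; [unfold bell; simpl; rewrite Rabs_R1; lra|].
  rewrite bell_S.
  assert (P : (0 < INR (S n))%R) by (apply lt_0_INR; lia).
  assert (H : (Rabs (sum_f_R0 (fun j => bell j * / INR (fact (n - j))) n) <= INR (S n))%R).
  { eapply Rle_trans; [apply Rsum_abs|].
    rewrite <- (Rmult_1_l (INR (S n))), <- sum_cte.
    apply sum_Rle; intros j Hj.
    pose proof (inv_fact_bound (n - j)); pose proof (IH j ltac:(lia)).
    rewrite Rabs_mult, (Rabs_pos_eq (/ _)) by lra. pose proof (Rabs_pos (bell j)). nra. }
  rewrite Rabs_mult, Rabs_pos_eq by (apply Rlt_le, Rinv_0_lt_compat; lra).
  apply (Rmult_le_reg_l (3 * INR (S n))); [lra|].
  rewrite <- Rmult_assoc, Rinv_r, Rmult_1_l by lra; lra.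
Qed.

Definition bell_coef (k : nat) : C := RtoC (bell k).

Lemma abs_conv_bell_coef : abs_conv bell_coef.
Proof.
  apply (abs_conv_bounded _ 1); intros k.
  unfold bell_coef; rewrite Cmod_R; apply bell_bound.
Qed.

Lemma psum_dcoef_bell (z : C) :
  in_disk z -> psum (dcoef bell_coef) z = / 3 * cexp z * psum bell_coef z.
Proof.
  intros Hz.
  assert (A : forall b, abs_conv b -> ex_series (fun k => Cmod (b k * z ^ k))).
  { intros b Hb; apply (ex_series_ext (fun k => Cmod (b k) * Cmod z ^ k)%R).
    - intros k; now rewrite Cmod_mult, Cmod_pow.
    - apply Hb; split; [apply Cmod_ge_0|exact Hz]. }
  pose proof abs_conv_bell_coef as Hb; pose proof abs_conv_exp_coef as He.
  pose proof (is_Cseries_cauchy_product _ _ _ _ (psum_correct _ z Hb Hz) (psum_correct _ z He Hz)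
    (A _ Hb) (A _ He)) as P.
  rewrite psum_exp_coef in P by exact Hz.
  transitivity (/ 3 * (psum bell_coef z * cexp z)); [|ring].
  apply (is_Cseries_unique _ _ _ (psum_correct _ z (abs_conv_dcoef _ Hb) Hz)).
  apply (is_Cseries_ext _ _ _) with (2 := is_Cseries_scal (/ 3) _ _ P).
  intros n.
  (* The summand itself depends on n, so n stays fixed and the induction runs over the upper limit
     m. *)
  assert (H : forall m, (m <= n)%nat ->
    Csum (fun k => bell_coef k * z ^ k * (exp_coef (n - k) * z ^ (n - k))) m =
    z ^ n * RtoC (sum_f_R0 (fun j => bell j * / INR (fact (n - j))) m)%R).
  { assert (T : forall k, (k <= n)%nat ->
      bell_coef k * z ^ k * (exp_coef (n - k) * z ^ (n - k)) =
      z ^ n * RtoC (bell k * / INR (fact (n - k)))%R).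
    { intros k Hk; replace (z ^ n) with (z ^ k * z ^ (n - k)).
      - unfold bell_coef, exp_coef; rewrite RtoC_mult; ring.
      - rewrite <- Cpow_add_r; f_equal; lia. }
    induction m; intros Hm.
    - rewrite Csum_0, T by lia; reflexivity.
    - rewrite Csum_S, T, IHm by lia; simpl sum_f_R0; rewrite RtoC_plus; ring. }
  rewrite H by lia; unfold dcoef, bell_coef; rewrite bell_S.
  assert (P3 : RtoC (INR (S n)) <> 0).
  { intros Z; apply RtoC_inj in Z; apply not_0_INR in Z; [easy|lia]. }
  rewrite RtoC_mult, RtoC_inv, RtoC_mult.
  - field; exact P3.
  - pose proof (pos_INR n); rewrite S_INR; lra.
Qed.

Lemma C3_neq_0 : RtoC 3 <> 0.
Proof. intros Z; apply RtoC_inj in Z; lra. Qed.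

Lemma is_Cderive_bell_exponent (z : C) :
  is_Cderive (fun z => (cexp z - 1) / 3) z (/ 3 * cexp z).
Proof.
  eapply is_Cderive_of_eq.
  - apply (is_Cderive_mult (fun z => cexp z - 1) (fun _ => / 3)); [|apply is_Cderive_const].
    apply (is_Cderive_minus cexp (fun _ => 1)); [apply is_Cderive_cexp|apply is_Cderive_const].
  - simpl; field; apply C3_neq_0.
Qed.

Lemma psum_bell_coef (z : C) : in_disk z -> psum bell_coef z = cexp ((cexp z - 1) / 3).
Proof.
  intros Hz; set (phi := fun z => (cexp z - 1) / 3).
  assert (H : psum bell_coef z * cexp (- phi z) = psum bell_coef 0 * cexp (- phi 0)).
  { apply (linear_ode_unique (psum bell_coef) phi (fun z => / 3 * cexp z)); [| |exact Hz].
    - intros x _; apply is_Cderive_bell_exponent.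
    - intros x Hx; rewrite <- psum_dcoef_bell by exact Hx.
      apply is_Cderive_psum; [apply abs_conv_bell_coef|exact Hx]. }
  assert (P0 : - phi 0 = 0) by (unfold phi; rewrite cexp_0; field; apply C3_neq_0).
  rewrite psum_at_0, P0, cexp_0 in H by apply abs_conv_bell_coef.
  change (bell_coef 0) with (RtoC 1) in H.
  fold (phi z).
  transitivity (psum bell_coef z * (cexp (- phi z) * cexp (phi z))); [rewrite cexp_opp_l; ring|].
  rewrite Cmult_assoc, H; ring.
Qed.

(** The coefficients of z E(z^3), where E has coefficients [bell]. *)
Definition extremal_coef (k : nat) : C :=
  if Nat.eqb (k mod 3) 1 then bell_coef (k / 3) else 0.

Lemma extremal_coef_1 (n : nat) : extremal_coef (n * 3 + 1) = bell_coef n.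
Proof.
  unfold extremal_coef.
  rewrite (Nat.add_comm (n * 3)), Nat.Div0.mod_add, Nat.div_add by lia; reflexivity.
Qed.

Lemma extremal_coef_2 (n : nat) : extremal_coef (n * 3 + 2) = 0.
Proof. unfold extremal_coef; now rewrite (Nat.add_comm (n * 3)), Nat.Div0.mod_add. Qed.

Lemma extremal_coef_3 (n : nat) : extremal_coef (n * 3 + 3) = 0.
Proof.
  unfold extremal_coef; replace (n * 3 + 3)%nat with (0 + (n + 1) * 3)%nat by lia.
  now rewrite Nat.Div0.mod_add.
Qed.

Lemma abs_conv_extremal_coef : abs_conv extremal_coef.
Proof.
  apply (abs_conv_bounded _ 1); intros k; unfold extremal_coef.
  destruct (Nat.eqb _ _).
  - unfold bell_coef; rewrite Cmod_R; apply bell_bound.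
  - rewrite Cmod_0; lra.
Qed.

Lemma in_disk_cube (z : C) : in_disk z -> in_disk (z * z * z).
Proof.
  unfold in_disk; rewrite !Cmod_mult; pose proof (Cmod_ge_0 z); intros H1.
  assert (Cmod z * Cmod z < 1)%R by nra. nra.
Qed.

Lemma Csum_extremal (z : C) (n : nat) :
  Csum (fun k => extremal_coef k * z ^ k) (n * 3 + 1) =
  z * Csum (fun k => bell_coef k * (z * z * z) ^ k) n.
Proof.
  induction n.
  - rewrite Csum_0; simpl Nat.add; rewrite Csum_S, Csum_0.
    change (extremal_coef 1) with (bell_coef 0); unfold extremal_coef; simpl; ring.
  - replace (S n * 3 + 1)%nat with (S (S (S (n * 3 + 1)))) by lia.
    rewrite !Csum_S, IHn.
    replace (S (n * 3 + 1)) with (n * 3 + 2)%nat by lia.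
    replace (S (n * 3 + 2)) with (n * 3 + 3)%nat by lia.
    replace (S (n * 3 + 3)) with (S n * 3 + 1)%nat by lia.
    rewrite extremal_coef_1, extremal_coef_2, extremal_coef_3.
    replace (z ^ (S n * 3 + 1)) with (z * (z * z * z) ^ S n); [ring|].
    rewrite Cpow_add_r, Nat.mul_comm, Cpow_mult_r, Cpow_1_r.
    replace (z ^ 3) with (z * z * z) by ring; ring.
Qed.

(** Convergence of the full sequence of partial sums is already known, so it is enough to identify
    the limit along the indices 3n + 1, where they equal z times the partial sums of E at z^3. *)
Lemma psum_extremal_coef (z : C) : in_disk z -> psum extremal_coef z = f_extremal z.
Proof.
  intros Hz; pose proof (in_disk_cube z Hz) as Hz3.
  unfold f_extremal; rewrite <- psum_bell_coef by exact Hz3.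
  pose proof (psum_correct _ z abs_conv_extremal_coef Hz) as H1.
  pose proof (is_Cseries_scal z _ _ (psum_correct _ _ abs_conv_bell_coef Hz3)) as H2.
  assert (H3 : filterlim (fun n => (n * 3 + 1)%nat) eventually eventually).
  { intros P [N HN]; exists N; intros n Hn; apply HN; lia. }
  set (l1 := psum extremal_coef z) in *.
  set (l2 := z * psum bell_coef (z * z * z)) in *.
  set (c := fun k => extremal_coef k * z ^ k) in *.
  assert (L1 : filterlim (fun n => Csum c (n * 3 + 1)) eventually (@locally C_NormedModule l1)).
  { exact (filterlim_comp _ _ _ (fun n => (n * 3 + 1)%nat) (Csum c) _ _ _ H3 H1). }
  assert (L2 : filterlim (fun n => Csum c (n * 3 + 1)) eventually (@locally C_NormedModule l2)).
  { apply (filterlim_ext (Csum (fun k => z * (bell_coef k * (z * z * z) ^ k)))); [|exact H2].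
    intros n; unfold c; rewrite Csum_extremal.
    apply (sum_n_mult_l (K := C_Ring) z (fun k => bell_coef k * (z * z * z) ^ k)). }
  exact (filterlim_locally_unique (V := C_NormedModule) _ l1 l2 L1 L2).
Qed.

Lemma is_Cderive_f_extremal (z : C) :
  is_Cderive f_extremal z
    (cexp ((cexp (z * z * z) - 1) / 3) * (1 + z * z * z * cexp (z * z * z))).
Proof.
  eapply is_Cderive_of_eq.
  - apply (is_Cderive_mult (fun z => z) (fun z => cexp ((cexp (z * z * z) - 1) / 3)));
      [apply is_Cderive_id|].
    apply (is_Cderive_comp cexp (fun z => (cexp (z * z * z) - 1) / 3)); [apply is_Cderive_cexp|].
    apply (is_Cderive_comp (fun z => (cexp z - 1) / 3) (fun z => z * z * z));
      [apply is_Cderive_bell_exponent|].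
    apply (is_Cderive_mult (fun z => z * z) (fun z => z)); [|apply is_Cderive_id].
    apply (is_Cderive_mult (fun z => z) (fun z => z)); apply is_Cderive_id.
  - simpl; field; apply C3_neq_0.
Qed.

Lemma in_S_wp_f_extremal : in_S_wp f_extremal extremal_coef.
Proof.
  split; [split; [|split; reflexivity]|].
  - intros z Hz; apply is_pseries_iff; rewrite <- psum_extremal_coef by exact Hz.
    apply psum_correct; [apply abs_conv_extremal_coef|exact Hz].
  (* Logarithmic differentiation gives z f'/f = 1 + z^3 exp(z^3), which is [wp] at z^3. *)
  - exists (fun z => z * z * z); split; [split; [|split]|].
    + apply (analytic_mult (fun z => z * z) (fun z => z)); [|apply analytic_id].
      apply (analytic_mult (fun z => z) (fun z => z)); apply analytic_id.
    + ring.
    + exact in_disk_cube.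
    + intros z Hz Nz.
      assert (N : f_extremal z <> 0) by (apply Cmult_neq_0; [exact Nz|apply cexp_neq_0]).
      split; [exact N|].
      eexists; split; [apply is_Cderive_f_extremal|].
      unfold f_extremal, wp; simpl.
      pose proof (cexp_neq_0 ((cexp (z * z * z) - 1) / 3)) as N2.
      set (x := cexp ((cexp (z * z * z) - 1) / 3)) in *; field; auto.
Qed.

Lemma three_fold_f_extremal : three_fold_symmetric f_extremal.
Proof.
  intros z _; unfold f_extremal.
  replace (eps3 * z * (eps3 * z) * (eps3 * z)) with (eps3 * eps3 * eps3 * (z * z * z)) by ring.
  rewrite eps3_cube, Cmult_1_l; ring.
Qed.

Lemma bell_1 : bell 1 = (1 / 3)%R.
Proof. rewrite bell_S; unfold bell; simpl; field. Qed.

Theorem mainTheorem18 :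
  (forall (f : C -> C) (b : nat -> C),
      in_S_wp f b -> three_fold_symmetric f ->
      Cmod (H3 b) = (Cmod (b 4%nat) ^ 2)%R /\ (Cmod (b 4%nat) ^ 2 <= 1 / 9)%R) /\
  (three_fold_symmetric f_extremal /\
   exists b : nat -> C, in_S_wp f_extremal b /\ Cmod (H3 b) = (1 / 9)%R).
Proof.
  split; [exact three_fold_H3|split; [exact three_fold_f_extremal|]].
  exists extremal_coef; split; [exact in_S_wp_f_extremal|].
  destruct (three_fold_H3 _ _ in_S_wp_f_extremal three_fold_f_extremal) as [-> _].
  (* The index 4 = 3 * 1 + 1 carries the coefficient of z in E. *)
  change (extremal_coef 4) with (RtoC (bell 1)).
  rewrite bell_1, Cmod_R, Rabs_pos_eq by lra; field.
Qed.
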